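(* Let $N,n\in\mathbb{Z}_{\ge1}$ and $\underline t=(t_3,t_5,\ldots,t_{2N-1})\in\mathbb{C}^{N-1}$. For every $x\in\mathbb{C}$, $$\Big(\mathcal{Q}_n^{[N]}(x;\underline t)\Big)^2=(-1)^{\binom{n+1}{2}}\frac{1}{2^n}\prod_{k=1}^n\left[\frac{(2k)!}{k!}\right]^2\det\Big[\mu_{\ell+j-2}^{[N]}(\mathbf t_o)\Big]_{\ell,j=1}^{n+1},$$ where $\mathbf t_o=(t_1,0,t_3,0,t_5,\ldots,t_{2N-1},0,t_{2N+1},0,0,0,\ldots)$ with $t_1=x$ and $t_{2N+1}=-\frac1{2N+1}$, and the coefficients $\mu_k^{[N]}(\mathbf t_o)$ are defined by $$\exp\Big[\sum_{j\ge 1}t_jw^j\Big]=\sum_{k=0}^\infty\mu_k^{[N]}(\mathbf t_o)w^k,$$ with $t_j=0$ for even $j$ and for $j>2N+1$.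
   Context: Lenard operators: the differential polynomials $\mathcal{L}_k[u]$ are defined by $\frac{d}{dx}\mathcal{L}_{k+1}[u]=\left(\frac{d^3}{dx^3}+4u\frac{d}{dx}+2u_x\right)\mathcal{L}_k[u]$ for $k\ge 0$, $\mathcal{L}_0[u]=\frac12$, with the integration constants fixed by $\mathcal{L}_k[0]=0$ for $k\ge1$. Generalized Vorob'ev-Yablonski polynomials: $\mathcal{Q}_n^{[N]}(x;\underline t)$ is defined by $\mathcal{Q}_0^{[N]}=1$, $\mathcal{Q}_1^{[N]}=x$ and, for $n\ge1$, $$\mathcal{Q}_{n+1}^{[N]}\mathcal{Q}_{n-1}^{[N]}=\big(\mathcal{Q}_n^{[N]}\big)^2\Big\{x-2\mathcal{L}_N\Big[2\tfrac{d^2}{dx^2}\ln\mathcal{Q}_n^{[N]}\Big]+2\sum_{k=1}^{N-1}(2k+1)t_{2k+1}\mathcal{L}_k\Big[2\tfrac{d^2}{dx^2}\ln\mathcal{Q}_n^{[N]}\Big]\Big\}.$$ *)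

(* Defs.v *)
From HB Require Import structures.
From mathcomp Require Import all_boot all_order all_algebra.
From mathcomp Require Import finmap.
From mathcomp Require Import boolp classical_sets reals.
From mathcomp Require Import complex.
From mathcomp.multinomials Require Import monalg.

Set Implicit Arguments.
Unset Strict Implicit.
Unset Printing Implicit Defensive.

Import GRing.Theory.

Local Open Scope ring_scope.

Notation "x %:F" := (@FracField.tofrac _ x) : ring_scope.

Section RationalFunctions.
Variable F : fieldType.

(* The value does not depend on the representative chosen by repr. *)
Definition ratderiv (r : {fraction {poly F}}) : {fraction {poly F}} :=
  let p := \n_(repr r) in let q := \d_(repr r) in
  (p^`() * q - p * q^`())%:F / q%:F ^+ 2.

(* d^2/dx^2 ln r, with d/dx ln r = r' / r. *)
Definition d2ln (r : {fraction {poly F}}) : {fraction {poly F}} :=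
  ratderiv (ratderiv r / r).

End RationalFunctions.

(* Differential polynomials in u: polynomials in indeterminates u_0, u_1, ...,
   where u_i stands for the i-th derivative of u. *)
Notation diffpoly F := {malg F[{cmonom nat}]}.

Section DifferentialPolynomials.
Variable F : fieldType.

Definition dvar (i : nat) : diffpoly F := << ucm i >>.

(* d/dx is the F-derivation with u_i |-> u_{i+1}: it maps a monomial m to the
   sum over i of (m i) * (m / u_i) * u_{i+1}. *)
Definition dtotal (P : diffpoly F) : diffpoly F :=
  \sum_(m <- msupp P) \sum_(i <- finsupp m)
    << P@_m *+ m i *g mulcm (divcm m (ucm i)) (ucm i.+1) >>.

(* P[u], obtained by substituting the i-th derivative of u for u_i. *)
Definition deval (P : diffpoly F) (u : {fraction {poly F}}) :
    {fraction {poly F}} :=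
  mmap (@FracField.tofrac {poly F} \o polyC)
       (fun m : {cmonom nat} =>
          \prod_(i <- finsupp m) iter i (@ratderiv F) u ^+ m i) P.

(* The step case selects the solution P = L_{k+1} of
     d/dx P = (d^3/dx^3 + 4 u d/dx + 2 u_x) L_k   and   P[0] = 0;
   in characteristic 0 it exists and is unique. *)
Fixpoint lenard (k : nat) : diffpoly F :=
  if k is k'.+1 then
    xget 0 [set P : diffpoly F |
      dtotal P = dtotal (dtotal (dtotal (lenard k')))
                 + 4%:R *: (dvar 0 * dtotal (lenard k'))
                 + 2%:R *: (dvar 1 * lenard k')
      /\ deval P 0 = 0]%classic
  else malgC (2%:R^-1).

End DifferentialPolynomials.

Section VorobevYablonski.
Variable F : fieldType.

(* The parameter t_{2k+1}, for 1 <= k <= N-1, is t 0 (k-1): in sums over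
   k < N.-1 below, t 0 k is t_{2k+3}. *)

Definition gvy_factor (N : nat) (t : 'rV[F]_N.-1) (q : {fraction {poly F}}) :
    {fraction {poly F}} :=
  let u := 2%:R * d2ln q in
  'X%:F - 2%:R * deval (lenard F N) u
  + 2%:R * \sum_(k < N.-1)
      ((2 * k + 3)%:R * t 0 k)%:P%:F * deval (lenard F k.+1) u.

(* The recurrence is solved for its leading member in the field of rational
   functions. That every gvy N t n is in fact a (nonzero) polynomial is a
   theorem, not part of this definition. *)
Fixpoint gvy (N : nat) (t : 'rV[F]_N.-1) (n : nat) : {fraction {poly F}} :=
  match n with
  | 0 => 1
  | n1.+1 =>
      match n1 with
      | 0 => 'X%:F
      | n2.+1 => gvy t n1 ^+ 2 * gvy_factor t (gvy t n1) / gvy t n2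
      end
  end.

(* The coefficient of w^k in the formal power series exp(p(w)) = sum_m p^m/m!
   when p(0) = 0: then p^m contributes to w^k only if m <= k. *)
Definition expcoef (p : {poly F}) (k : nat) : F :=
  (\sum_(m < k.+1) (m`!%:R)^-1 *: p ^+ m)`_k.

(* sum_j t_j w^j for the vector t_o: t_1 = x, t_{2N+1} = -1/(2N+1). *)
Definition time_poly (N : nat) (t : 'rV[F]_N.-1) (x : F) : {poly F} :=
  x *: 'X + \sum_(k < N.-1) t 0 k *: 'X^(2 * k + 3)
  - ((2 * N + 1)%:R)^-1 *: 'X^(2 * N + 1).

Definition mu (N : nat) (t : 'rV[F]_N.-1) (x : F) (k : nat) : F :=
  expcoef (time_poly t x) k.

End VorobevYablonski.

(* Main.v *)
From HB Require Import structures.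
Require Import Defs.
From mathcomp Require Import all_boot all_order all_algebra.
From mathcomp Require Import finmap.
From mathcomp Require Import boolp classical_sets reals complex.
From mathcomp.multinomials Require Import monalg.
From mathcomp Require Import ring zify.

Set Implicit Arguments.
Unset Strict Implicit.
Unset Printing Implicit Defensive.

Import GRing.Theory.

Local Open Scope ring_scope.

(** Write [E = exp (sum_j t_j w^j)] over the field of rational functions in [x = t_1], and let [q_k] be the monic
    polynomial of degree [k] in [w] with [q_k(w) E(w) - q_k(-w) = O(w^(2k+1))]. Since only odd times occur,
    [E(w) E(-w) = 1], and this Pade problem has a unique solution. Differentiating in [x] (where [E' = w E]) gives a
    Darboux chain linking [q_k] and [q_{k+1}], hence [q_k'' + w q_k' + u_k q_k = 0]; the constant terms [b_k] of the
    [q_k] satisfy [b_k = kappa_k tau_{k-1} / tau_k] with [u_k = 2 (ln tau_k)''] and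
    [kappa_k = (-1)^k (2k)! / k!]. The product [q_k(w) q_k(-w)] then satisfies the quadratic first integral that
    characterises the generating function [2 sum_j L_j[u_k] w^(-2j)] of the Lenard polynomials. Extracting the
    coefficient of [w^(2k)] from the derivative in [w] of the Pade relation shows that [tau_k] obeys the recurrence
    of the generalized Vorob'ev-Yablonski polynomials. On the other hand [(q_k + w q_{k-1}) / b_k] is a reversed
    orthogonal polynomial for the moments [mu_j], so that ratios of consecutive Hankel determinants are, up to
    explicit constants, squares of [tau_k / tau_{k-1}]. *)

(** * Reflection and reversal of polynomials *)

Section Polynomials.
Variable K : fieldType.
Implicit Types p q r : {poly K}.

Lemma dvdXnP n p :
  reflect (forall i, (i < n)%N -> p`_i = 0) ('X^n %| p).
Proof.
apply: (iffP idP) => [/dvdpP[q ->] i lt_in | p0].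
  by rewrite coefMXn lt_in.
rewrite -[p](poly_take_drop n) (_ : take_poly n p = 0) ?add0r ?dvdp_mull //.
apply/polyP=> i; rewrite coef_take_poly coef0.
by case: ifP => // /p0.
Qed.

Lemma dvdXn_le m n p : (m <= n)%N -> 'X^n %| p -> 'X^m %| p.
Proof. by move=> le_mn; apply: dvdp_trans; rewrite dvdp_exp2l. Qed.

Lemma dvdXn_MXn m n p q :
  'X^m %| p -> 'X^n %| q -> 'X^(m + n) %| p * q.
Proof. by rewrite exprD; apply: dvdp_mul. Qed.

Lemma coef_dvdXnM n p q : 'X^n %| p -> (p * q)`_n = p`_n * q`_0.
Proof.
case/dvdpP=> r ->; rewrite mulrAC !coefMXn ltnn subnn.
by rewrite coefM big_ord1.
Qed.

Lemma dvdXn_deriv n p : 'X^n %| p -> 'X^(n.-1) %| p^`().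
Proof.
move/dvdXnP=> p0; apply/dvdXnP=> i lt_in.
by rewrite coef_deriv p0 ?mul0rn //; lia.
Qed.

Definition flip p := p \Po (- 'X).

Lemma flip_is_additive : additive flip.
Proof. by move=> p q; rewrite /flip comp_polyB. Qed.

Lemma flip_is_multiplicative : multiplicative flip.
Proof.
by split=> [p q|]; rewrite /flip ?comp_polyM // comp_polyC.
Qed.

HB.instance Definition _ := GRing.isAdditive.Build _ _ flip flip_is_additive.
HB.instance Definition _ :=
  GRing.isMultiplicative.Build _ _ flip flip_is_multiplicative.

Lemma flip_natl n p : flip (n%:R * p) = n%:R * flip p.
Proof. by rewrite rmorphM rmorph_nat. Qed.

Lemma flipX : flip 'X = - 'X.
Proof. by rewrite /flip comp_polyX. Qed.

Lemma flipC c : flip c%:P = c%:P.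
Proof. by rewrite /flip comp_polyC. Qed.

Lemma flipZ c p : flip (c *: p) = c *: flip p.
Proof. by rewrite /flip comp_polyZ. Qed.

Lemma coef_flip p i : (flip p)`_i = (-1) ^+ i * p`_i.
Proof.
elim/poly_ind: p i => [|p c IHp] i; first by rewrite rmorph0 coef0 mulr0.
rewrite rmorphD rmorphM /= flipX flipC mulrN !coefD coefN !coefMX !coefC.
case: i => [|i] /=; first by rewrite expr0 oppr0 mul1r.
by rewrite !addr0 IHp exprS mulN1r mulNr.
Qed.

Lemma size_flip p : size (flip p) = size p.
Proof. by rewrite size_comp_poly2 // size_polyN size_polyX. Qed.

Lemma flipK : involutive flip.
Proof.
by move=> p; apply/polyP=> i; rewrite !coef_flip mulrA -expr2 sqrr_sign mul1r.
Qed.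

Lemma deriv_flip p : (flip p)^`() = - flip p^`().
Proof. by rewrite /flip deriv_comp derivN derivX mulrN1. Qed.

Lemma dvdXn_flip n p : ('X^n %| flip p) = ('X^n %| p).
Proof.
apply/dvdXnP/dvdXnP => p0 i /p0; rewrite coef_flip; last by move->; rewrite mulr0.
by move/eqP; rewrite mulf_eq0 signr_eq0 => /eqP.
Qed.

(** For [p] of degree at most [n] this is [w^n p(1/w)]. The formal degree is an argument so that the
    map is linear in [p] and commutes with coefficientwise derivations. *)
Definition revp n p := \poly_(i < n.+1) p`_(n - i).

Lemma revp_is_linear n : linear (revp n).
Proof.
move=> c p q; apply/polyP=> i; rewrite coefD coefZ !coef_poly.
by case: ifP => _; rewrite ?mulr0 ?addr0 // coefD coefZ.
Qed.

HB.instance Definition _ n :=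
  GRing.isLinear.Build _ _ _ _ (revp n) (revp_is_linear n).

Lemma coef_revp n p i : (i <= n)%N -> (revp n p)`_i = p`_(n - i).
Proof. by move=> le_in; rewrite coef_poly ltnS le_in. Qed.

Lemma revpXn n i : (i <= n)%N -> revp n 'X^i = 'X^(n - i).
Proof.
move=> le_in; apply/polyP=> j; rewrite coef_poly !coefXn.
case: ltnP => [|lt_nj]; first by rewrite ltnS => le_jn; congr (_%:R); lia.
by rewrite (_ : (j == n - i)%N = false) //; lia.
Qed.

Lemma revpM n m p q : (size p <= n.+1)%N -> (size q <= m.+1)%N ->
  revp (n + m) (p * q) = revp n p * revp m q.
Proof.
have E k r : (size r <= k.+1)%N -> r = \sum_(i < k.+1) r`_i *: 'X^i.
  by move=> le_rk; rewrite -poly_def -[LHS](take_poly_id le_rk).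
move=> /E-> /E->; rewrite !linear_sum mulr_suml /= mulr_suml linear_sum.
apply: eq_bigr => i _; rewrite mulr_sumr mulr_sumr linear_sum.
apply: eq_bigr => j _; have [le_in le_jm] := (ltn_ord i, ltn_ord j).
rewrite -!scalerAl -!scalerAr !linearZ /= -exprD.
rewrite !revpXn ?leq_add // -!scalerAl -scalerAr -exprD.
by congr (_ *: (_ *: 'X^_)); lia.
Qed.

End Polynomials.

(** * Derivations *)

Section Derivations.

Definition is_derivation (A : pzRingType) (D : A -> A) :=
  {morph D : a b / a + b} /\ forall a b, D (a * b) = D a * b + a * D b.

Variables (A : comPzRingType) (D : A -> A) (derD : is_derivation D).

Lemma der_add a b : D (a + b) = D a + D b. Proof. by case: derD. Qed.

Lemma der_mul a b : D (a * b) = D a * b + a * D b. Proof. by case: derD. Qed.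

Lemma der0 : D 0 = 0.
Proof. by apply: (addrI (D 0)); rewrite -der_add !addr0. Qed.

Lemma der_opp a : D (- a) = - D a.
Proof. by apply: (addIr (D a)); rewrite -der_add !addNr der0. Qed.

Lemma der_sub a b : D (a - b) = D a - D b.
Proof. by rewrite der_add der_opp. Qed.

Lemma der1 : D 1 = 0.
Proof.
by have := der_mul 1 1; rewrite !mulr1 mul1r => /esym/(canRL (addrK _))->; rewrite subrr.
Qed.

Lemma der_sum I (r : seq I) (P : pred I) (f : I -> A) :
  D (\sum_(i <- r | P i) f i) = \sum_(i <- r | P i) D (f i).
Proof. exact: (big_morph D der_add der0). Qed.

Lemma der_mulrn a n : D (a *+ n) = D a *+ n.
Proof. by elim: n => [|n IHn]; rewrite ?mulr0n ?der0 // !mulrS der_add IHn. Qed.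

Lemma der_nat n : D n%:R = 0.
Proof. by rewrite der_mulrn der1 mul0rn. Qed.

Lemma der_natl n a : D (n%:R * a) = n%:R * D a.
Proof. by rewrite !mulr_natl der_mulrn. Qed.

Lemma der_sign n : D ((-1) ^+ n) = 0.
Proof. by rewrite -signr_odd; case: odd; rewrite ?der_opp der1 ?oppr0. Qed.

Lemma der_exp a n : D (a ^+ n) = D a * a ^+ n.-1 *+ n.
Proof.
elim: n => [|n IHn]; first by rewrite expr0 der1 mulr0n.
rewrite exprS der_mul IHn /=; case: n {IHn} => [|n]; first by rewrite mulr0n mulr0 addr0.
by rewrite /= mulrnAr mulrCA -exprS -mulrS.
Qed.

End Derivations.

Section FieldDerivation.
Variables (K : fieldType) (D : K -> K) (derD : is_derivation D).

Definition dlog a := D a / a.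

Lemma dlogM a b : a != 0 -> b != 0 -> dlog (a * b) = dlog a + dlog b.
Proof.
by move=> a0 b0; rewrite /dlog (der_mul derD); field; rewrite ?a0 ?b0.
Qed.

Lemma der_inv a : a != 0 -> D a^-1 = - D a / a ^+ 2.
Proof.
move=> a0; have /eqP := der_mul derD a a^-1.
rewrite divff // (der1 derD) eq_sym addrC addr_eq0 => /eqP E.
by apply: (mulfI a0); rewrite E; field.
Qed.

End FieldDerivation.

Section CoefficientDerivation.
Variables (A : comNzRingType) (d : A -> A) (der_d : is_derivation d).

(** Polynomials in [w] have coefficients depending on [x]: this is the derivative in [x], while
    [deriv] is the one in [w]. *)
Definition dcoef (p : {poly A}) := map_poly d p.

Lemma coef_dcoef p i : (dcoef p)`_i = d p`_i.
Proof. by rewrite coef_map_id0 // (der0 der_d). Qed.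

Lemma dcoef_derivation : is_derivation dcoef.
Proof.
split=> p q; apply/polyP=> i; rewrite !(coef_dcoef, coefD) ?(der_add der_d) //.
rewrite !coefM (der_sum der_d) -big_split; apply: eq_bigr => j _ /=.
by rewrite !coef_dcoef (der_mul der_d).
Qed.

Lemma dcoefX : dcoef 'X = 0.
Proof. by apply/polyP=> i; rewrite coef_dcoef coefX coef0 (der_nat der_d). Qed.

Lemma dcoefC c : dcoef c%:P = (d c)%:P.
Proof.
apply/polyP=> i; rewrite coef_dcoef !coefC.
by case: ifP; rewrite // (der0 der_d).
Qed.

Lemma dcoef_mulXn p n : dcoef (p * 'X^n) = dcoef p * 'X^n.
Proof.
apply/polyP=> i; rewrite coef_dcoef !coefMXn coef_dcoef.
by case: ifP; rewrite ?(der0 der_d).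
Qed.

Lemma size_dcoef p : (size (dcoef p) <= size p)%N.
Proof. exact: size_poly. Qed.

End CoefficientDerivation.

Section FieldCoefficientDerivation.
Variables (K : fieldType) (d : K -> K) (der_d : is_derivation d).

Lemma dcoef_flip p : dcoef d (flip p) = flip (dcoef d p).
Proof.
apply/polyP=> i; rewrite !(coef_flip, coef_dcoef) // (der_mul der_d).
by rewrite (der_sign der_d) mul0r add0r.
Qed.

Lemma dvdXn_dcoef n p : 'X^n %| p -> 'X^n %| dcoef d p.
Proof.
move/dvdXnP=> p0; apply/dvdXnP=> i /p0 E.
by rewrite coef_dcoef // E (der0 der_d).
Qed.

End FieldCoefficientDerivation.

(** * Pade approximation of an exponential *)

Section Pade.
Variables (K : fieldType) (natr_neq0 : forall n, n.+1%:R != 0 :> K).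
Variables (M : nat) (E : {poly K}).
Hypothesis E0 : E`_0 = 1.
Hypothesis E1 : E`_1 != 0.
Hypothesis EF : 'X^M %| E * flip E - 1.
Implicit Types r : {poly K}.

(** The remainder when [r(-w) / r(w)] approximates [E(w)], a diagonal Pade problem. The series [E]
    is known only modulo ['X^M], which is why later statements bound [2k] by [M]. *)
Definition defect r := r * E - flip r.

Lemma defectB r1 r2 : defect (r1 - r2) = defect r1 - defect r2.
Proof. by rewrite /defect rmorphB /=; ring. Qed.

Lemma defectZ c r : defect (c *: r) = c *: defect r.
Proof. by rewrite /defect flipZ scalerBr scalerAl. Qed.

Lemma defect_mulX2 r : defect ('X^2 * r) = 'X^2 * defect r.
Proof. by rewrite /defect rmorphM rmorphXn /= flipX; ring. Qed.

Lemma two_neq0 : 2%:R != 0 :> K. Proof. exact: natr_neq0. Qed.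

(* By [E * flip E = 1], [flip] sends [defect r] to [- flip E * defect r], so its lowest order is odd. *)
Lemma defect_odd k r : (2 * k < M)%N ->
  'X^(2 * k) %| defect r -> 'X^((2 * k).+1) %| defect r.
Proof.
move=> lt_kM ord_r.
have flip_defect : 'X^M %| flip (defect r) + flip E * defect r.
  suff ->: flip (defect r) + flip E * defect r = r * (E * flip E - 1).
    by rewrite dvdp_mull.
  by rewrite /defect rmorphB rmorphM /= flipK; ring.
apply/dvdXnP=> i; rewrite ltnS leq_eqVlt => /predU1P[->|]; last first.
  by move: i; apply/dvdXnP.
move/dvdXnP/(_ _ lt_kM): flip_defect; rewrite coefD coef_flip mulrC.
rewrite [flip E * _]mulrC coef_dvdXnM // coef_flip E0 expr0 !mulr1.
rewrite mulrC mulnC exprM sqrr_sign mul1r -mulr2n -mulr_natl => /eqP.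
by rewrite mulf_eq0 (negPf two_neq0) => /eqP.
Qed.

Definition lead_defect k r := (defect r)`_(2 * k).+1.

(* The coefficient of [b] cancels the lowest order term of the defect of ['X^2 * a]. *)
Fixpoint pade_pair k : {poly K} * {poly K} :=
  if k is k'.+1 then
    let: (a, b) := pade_pair k' in
    (b, 'X^2 * a - (lead_defect k' a / lead_defect k b) *: b)
  else (1, 'X - (2%:R / E`_1)%:P).

Definition pade k := (pade_pair k).1.
Definition eps k := lead_defect k (pade k).

Lemma pade0 : pade 0 = 1. Proof. by []. Qed.

Lemma pade1 : pade 1 = 'X - (2%:R / E`_1)%:P. Proof. by []. Qed.

Lemma padeSS k : pade k.+2 = 'X^2 * pade k - (eps k / eps k.+1) *: pade k.+1.
Proof. by rewrite /eps /pade /=; case: (pade_pair k). Qed.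

Lemma eps0 : eps 0 = E`_1.
Proof. by rewrite /eps /lead_defect /defect rmorph1 mul1r coefB coef1 subr0. Qed.

Lemma pade_size k : (size (pade k) = k.+1) * ((pade k)`_k = 1).
Proof.
elim/ltn_ind: k => -[|[|k]] IHk; first by rewrite pade0 size_poly1 coef1.
  by rewrite pade1 size_XsubC coefB coefX coefC subr0.
have [IH1 IH2] := IHk k (leqnSn _); have [IH3 IH4] := IHk k.+1 (leqnn _).
have lead1 : (pade k.+2)`_k.+2 = 1.
  rewrite padeSS coefB coefZ coefXnM /= subn2 IH2.
  by rewrite [X in _ * X]nth_default ?IH3 // mulr0 subr0.
split=> //; apply/eqP; rewrite eqn_leq; apply/andP; split.
  rewrite padeSS (leq_trans (size_polyD _ _)) // size_polyN geq_max; apply/andP; split.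
    by rewrite (leq_trans (size_polyMleq _ _)) // size_polyXn IH1.
  by rewrite (leq_trans (size_scale_leq _ _)) // IH3.
rewrite ltnNge; apply/negP=> /(nth_default 0) Z.
by move/eqP: lead1; rewrite Z eq_sym oner_eq0.
Qed.

Lemma pade_neq0 k : pade k != 0.
Proof. by rewrite -size_poly_eq0 pade_size. Qed.

(** Normality of the Pade table up to [k]: the divisors in the recurrence do not vanish. It is
    carried as an assumption until [pade_nondeg] derives it from the Darboux relations. *)
Definition nondeg k := forall j, (j < k)%N -> eps j != 0.

(** Both terms of the recurrence for [pade k.+2] have a defect starting at order [2k+3], and the
    chosen coefficient cancels these leading terms. Parity, through [defect_odd], then gains one
    more order. *)
Lemma pade_order k : (2 * k < M)%N -> nondeg k ->
  'X^((2 * k).+1) %| defect (pade k).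
Proof.
elim/ltn_ind: k => -[|[|k]] IHk lt_kM nd.
- by apply: defect_odd => //; rewrite expr0 dvd1p.
- apply: defect_odd => //; apply/dvdXnP=> i.
  rewrite pade1 /defect mulrBl rmorphB /= flipX flipC.
  rewrite !(coefB, coefN, coefX, coefC, coefXM, coefCM).
  case: i => [|[|i]] //= _; first by rewrite E0; ring.
  (* The coefficient of [w] in the defect of ['X - c] is [2 - c E_1], whence the constant
     [c = 2 / E_1]. *)
  rewrite E0; field; exact: E1.
have nd1 : nondeg k.+1 by move=> j lt_j; apply: nd; lia.
have nd0 : nondeg k by move=> j lt_j; apply: nd; lia.
have ord0 := IHk k ltac:(lia) ltac:(lia) nd0.
have ord1 := IHk k.+1 ltac:(lia) ltac:(lia) nd1.
apply: defect_odd => //; apply/dvdXnP=> i lt_i.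
rewrite padeSS defectB defectZ defect_mulX2 coefB coefZ coefXnM.
have [lt_i'|ge_i] := ltnP i (2 * k.+1).+1.
  rewrite [X in _ * X](dvdXnP _ _ ord1) ?mulr0 ?subr0 //.
  by case: ifP => // _; apply: (dvdXnP _ _ ord0); lia.
have -> : i = (2 * k.+1).+1 by lia.
have /negbTE-> : ~~ ((2 * k.+1).+1 < 2)%N by lia.
rewrite (_ : (2 * k.+1).+1 - 2 = (2 * k).+1)%N; last by lia.
rewrite -/(lead_defect k _) -/(lead_defect k.+1 _) -/(eps k) -/(eps k.+1).
by rewrite divfK ?subrr //; apply: nd.
Qed.

(** Removing the multiple of [pade k.+1] with the same leading coefficient lowers the degree; by
    induction the rest is a multiple of [pade k]. Its defect would start at order [2k+1] with a
    nonzero multiple of [eps k], unless it is zero. *)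
Lemma pade_unique k r : (2 * k < M)%N -> nondeg k ->
  (size r <= k.+1)%N -> 'X^((2 * k).+1) %| defect r -> r = r`_k *: pade k.
Proof.
elim: k r => [|k IHk] r lt_kM nd sz_r ord_r.
  by rewrite pade0 alg_polyC; apply: size1_polyC.
have nd0 : nondeg k by move=> j lt_j; apply: nd; lia.
pose r' := r - r`_k.+1 *: pade k.+1.
have sz_r' : (size r' <= k.+1)%N.
  apply/leq_sizeP=> j; rewrite leq_eqVlt coefB coefZ => /predU1P[<-|lt_kj].
    by rewrite pade_size mulr1 subrr.
  rewrite nth_default ?(leq_trans sz_r) // [(pade _)`_j]nth_default ?pade_size //.
  by rewrite mulr0 subr0.
have ord_r' : 'X^((2 * k.+1).+1) %| defect r'.
  by rewrite defectB defectZ dvdp_sub // -mul_polyC dvdp_mull // pade_order.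
have {}sz_r' := IHk r' ltac:(lia) nd0 sz_r' (dvdXn_le _ ord_r').
have : (defect r')`_(2 * k).+1 = 0 by apply: (dvdXnP _ _ ord_r'); lia.
rewrite sz_r' ?defectZ ?coefZ; last by lia.
move/eqP; rewrite mulf_eq0 (negPf (nd k _)) // orbF => /eqP E'.
apply/eqP; rewrite -subr_eq0 -/r' sz_r' ?E' ?scale0r //; lia.
Qed.

Definition pade_const k := (pade k)`_0.

(** The constant term of the recurrence gives [b_(k+2) = - (eps_k / eps_(k+1)) b_(k+1)], so
    [eps_k b_(k+1)] only changes sign from one index to the next. *)
Lemma eps_pade_const k : nondeg k.+1 ->
  eps k * pade_const k.+1 = (-1) ^+ k.+1 * 2%:R.
Proof.
elim: k => [|k IHk] nd.
  rewrite eps0 /pade_const pade1 coefB coefX coefC /= sub0r expr1; field.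
  exact: E1.
have /IHk IH : nondeg k.+1 by move=> j lt_j; apply: nd; lia.
rewrite /pade_const padeSS coefB coefXnM coefZ /= sub0r exprS -mulrA -IH.
by rewrite -/(pade_const _); field; apply: nd.
Qed.

Lemma pade_const_neq0 k : nondeg k.+1 -> pade_const k.+1 != 0.
Proof.
move/eps_pade_const=> H; apply/eqP=> Z; move/eqP: H.
by rewrite Z mulr0 eq_sym mulf_eq0 signr_eq0 (negPf two_neq0).
Qed.

(* Both [defect]s vanish to order [2k+1], and the left-hand side has degree at most [2k+1]. *)
Lemma pade_wronskian k : (2 * k.+1 < M)%N -> nondeg k.+1 ->
  pade k * flip (pade k.+1) - pade k.+1 * flip (pade k) =
  ((-1) ^+ k.+1 * 2%:R) *: 'X^((2 * k).+1).
Proof.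
move=> lt_kM nd.
have nd0 : nondeg k by move=> j lt_j; apply: nd; lia.
have ord0 := pade_order (ltac:(lia) : (2 * k < M)%N) nd0.
have ord1 : 'X^((2 * k).+2) %| defect (pade k.+1).
  by apply: dvdXn_le (pade_order lt_kM nd); lia.
set w := LHS.
have Ew : w = pade k.+1 * defect (pade k) - pade k * defect (pade k.+1).
  by rewrite /w /defect; ring.
have sz_w : (size w <= (2 * k).+2)%N.
  rewrite (leq_trans (size_polyD _ _)) // size_polyN geq_max.
  by apply/andP; split; rewrite (leq_trans (size_polyMleq _ _)) //
    size_flip !pade_size; lia.
apply/polyP=> i; rewrite coefZ coefXn -eps_pade_const //.
case: (ltngtP i (2 * k).+1) => [lt_i|gt_i|->]; last 2 first.
- by rewrite mulr0 nth_default // (leq_trans sz_w).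
- rewrite Ew mulr1 coefB [_ * defect _]mulrC coef_dvdXnM ?ord0 //.
  rewrite [pade k * _]mulrC (_ : (defect (pade k.+1) * _)`_ _ = 0) ?subr0 //.
  by apply: (dvdXnP (2 * k).+2 _ (dvdp_mulr _ ord1)).
rewrite mulr0 Ew; apply: (dvdXnP _ _ _ i lt_i).
by rewrite dvdp_sub // dvdp_mull // (dvdXn_le _ ord1).
Qed.

(** * The Darboux chain in [x] *)

Section Darboux.
Variables (d : K -> K) (der_d : is_derivation d).
Hypothesis Ed : 'X^M %| dcoef d E - 'X * E.
Notation D := (dcoef d).
Let derD := dcoef_derivation der_d.

Lemma two_half : 2%:R * 2%:R^-1 = 1 :> K.
Proof. by rewrite divff // two_neq0. Qed.

(** The derivative in [x] conjugated by [exp(xw/2)]. Since [E' = w E], it acts on defects as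
    [D - w/2], hence preserves their order of vanishing. *)
Definition shiftD r := D r + 2%:R^-1 *: ('X * r).

Lemma defect_shiftD r :
  'X^M %| defect (shiftD r) - (D (defect r) - 2%:R^-1 *: ('X * defect r)).
Proof.
suff -> : defect (shiftD r) - (D (defect r) - 2%:R^-1 *: ('X * defect r)) =
  - r * (D E - 'X * E) by rewrite dvdp_mull.
rewrite /defect /shiftD (der_sub derD) (der_mul derD) dcoef_flip // rmorphD.
rewrite /= flipZ rmorphM /= flipX -!mul_polyC.
have -> : 'X * E = (2%:R^-1)%:P * ('X * E) + (2%:R^-1)%:P * ('X * E).
  rewrite -mulrDl -polyCD [X in X%:P](_ : _ = 1) ?mul1r //.
  by rewrite -[LHS]mulr2n -(mulr_natl 2%:R^-1) two_half.
by ring.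
Qed.

Lemma dvdXn_defect_shiftD n r : (n <= M)%N -> 'X^n %| defect r ->
  'X^n %| defect (shiftD r).
Proof.
move=> le_nM ord_r.
have := dvdXn_le le_nM (defect_shiftD r); rewrite dvdp_addl //.
rewrite dvdpNr dvdp_sub // ?dvdXn_dcoef //.
by rewrite -mul_polyC !dvdp_mull.
Qed.

Definition pade_s k := - (d (pade_const k.+1) / pade_const k.+1).

(** The terms in [w^(k+1)] cancel and the defect still vanishes to order [2k+1], so uniqueness
    leaves a multiple of [pade k]. The factor is identified in [darboux1], once [darboux2] is
    available. *)
Lemma darboux1_aux k : (2 * k.+1 < M)%N -> nondeg k.+1 ->
  exists s, shiftD (pade k) - 2%:R^-1 *: pade k.+1 = s *: pade k.
Proof.
move=> lt_kM nd; pose r := shiftD (pade k) - 2%:R^-1 *: pade k.+1.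
have nd0 : nondeg k by move=> j lt_j; apply: nd; lia.
have ord0 : 'X^((2 * k).+1) %| defect (pade k) by apply: pade_order => //; lia.
exists r`_k; apply: pade_unique => //; first by lia.
  apply/leq_sizeP=> j le_j.
  rewrite /r /shiftD coefB coefD !coefZ coefXM coef_dcoef //.
  case: j le_j => // j; rewrite /= ltnS leq_eqVlt => /predU1P[<-|lt_j].
    rewrite [(pade k)`_k.+1]nth_default ?pade_size // (der0 der_d).
    by rewrite add0r subrr.
  rewrite ![_`_j.+1]nth_default ?pade_size //; try lia.
  rewrite nth_default ?pade_size //.
  by rewrite (der0 der_d) add0r !mulr0 subrr.
rewrite /r defectB dvdp_sub // ?dvdXn_defect_shiftD //; first by lia.
rewrite defectZ -mul_polyC dvdp_mull //.
by apply: dvdXn_le (pade_order _ nd); lia.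
Qed.

(** Uniqueness again gives a multiple of [pade k.+1]; here the factor can be read off the constant
    term, to which the terms divisible by [w] contribute nothing. *)
Lemma darboux2 k : (2 * k.+1 < M)%N -> nondeg k.+1 ->
  shiftD (pade k.+1) - 2%:R^-1 *: ('X^2 * pade k) = - pade_s k *: pade k.+1.
Proof.
move=> lt_kM nd; set r := LHS.
have nd0 : nondeg k by move=> j lt_j; apply: nd; lia.
have ord0 : 'X^((2 * k).+1) %| defect (pade k) by apply: pade_order => //; lia.
have Er : r = r`_k.+1 *: pade k.+1.
  apply: pade_unique => //.
    apply/leq_sizeP=> j le_j.
    rewrite /r /shiftD coefB coefD !coefZ coefXM coefXnM coef_dcoef //.
    case: j le_j => [|[|j]] //=; rewrite ltnS leq_eqVlt subn2 /= => /predU1P[E'|lt_j].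
      case: E' => <-; rewrite [(pade k.+1)`_k.+2]nth_default ?pade_size // (der0 der_d).
      by rewrite add0r subrr.
    rewrite ![(pade k.+1)`__]nth_default ?pade_size //; try lia.
    rewrite nth_default ?pade_size //; try lia.
    by rewrite (der0 der_d) add0r !mulr0 subrr.
  rewrite /r defectB dvdp_sub // ?dvdXn_defect_shiftD ?pade_order //. 
  rewrite defectZ defect_mulX2 -mul_polyC dvdp_mull //.
  rewrite (_ : (2 * k.+1).+1 = 2 + (2 * k).+1)%N; last by lia.
  by apply: dvdXn_MXn.
have r0 : r`_0 = d (pade_const k.+1).
  rewrite /r /shiftD coefB coefD !coefZ coefXM coefXnM coef_dcoef //=.
  by rewrite !mulr0 addr0 subr0.
rewrite [LHS]Er; congr (_ *: _); have := congr1 (fun p : {poly K} => p`_0) Er.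
rewrite r0 coefZ -/(pade_const k.+1) /pade_s => ->; field.
exact: pade_const_neq0.
Qed.

(** The coefficient of [w^k] here and that of [w^(k+1)] in [darboux2] involve the same subleading
    coefficients with opposite signs, which determines the factor. *)
Lemma darboux1 k : (2 * k.+1 < M)%N -> nondeg k.+1 ->
  shiftD (pade k) - 2%:R^-1 *: pade k.+1 = pade_s k *: pade k.
Proof.
move=> lt_kM nd; have [s Es] := darboux1_aux lt_kM nd.
rewrite Es; congr (_ *: _).
have /(congr1 (fun p : {poly K} => p`_k)) := Es; have /(congr1 (fun p : {poly K} => p`_k.+1)) := darboux2 lt_kM nd.
rewrite /shiftD !(coefD, coefN, coefZ, coef_dcoef) //.
rewrite coefXM coefXnM /= !pade_size !mulr1 (der_nat der_d 1) !add0r coefXM.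
have -> : (if (k.+1 < 2)%N then 0 else (pade k)`_(k.+1 - 2)) =
    (if k == 0 then 0 else (pade k)`_k.-1).
  by case: k {lt_kM nd Es} => // k; rewrite subSS subn1.
set a := if _ then _ else _ => /(congr1 -%R); rewrite opprK => <- <-; ring.
Qed.

(* If [eps k.+1 = 0], the second Darboux relation forces [eps k = 0]; it starts from [eps 0 = E`_1]. *)
Lemma pade_nondeg k : (2 * k < M)%N -> nondeg k.
Proof.
elim: k => // -[|k] IHk lt_kM.
  by move=> -[|//] _; rewrite eps0.
have nd : nondeg k.+1 by apply: IHk; lia.
move=> j; rewrite ltnS leq_eqVlt => /predU1P[->|]; last exact: nd.
apply/eqP=> Z; have /eqP := nd k (leqnn _); apply.
have ord1 := pade_order (ltac:(lia) : (2 * k.+1 < M)%N) nd.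
have /eqP := darboux2 (ltac:(lia) : (2 * k.+1 < M)%N) nd.
rewrite subr_eq => /eqP/(congr1 (fun r : {poly K} => (defect r)`_(2 * k.+1).+1)).
have /dvdXnP/(_ (2 * k.+1).+1 ltac:(lia)) := defect_shiftD (pade k.+1).
rewrite (coefB (defect _)) (coefB (D _)) coefZ coef_dcoef //.
rewrite -[(defect (pade _))`__]/(eps k.+1).
rewrite Z (der0 der_d) coefXM /= (dvdXnP _ _ ord1); last by [].
rewrite mulr0 !subr0 => ->.
have -> : defect (- pade_s k *: pade k.+1 + 2%:R^-1 *: ('X^2 * pade k)) =
  - pade_s k *: defect (pade k.+1) + 2%:R^-1 *: ('X^2 * defect (pade k)).
  by rewrite -defect_mulX2 -!defectZ /defect rmorphD /=; ring.
rewrite coefD !coefZ -/(lead_defect k.+1 _) -/(eps k.+1) Z mulr0 add0r coefXnM.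
have -> : ((2 * k.+1).+1 - 2 = (2 * k).+1)%N by lia.
have /negbTE-> : ~~ ((2 * k.+1).+1 < 2)%N by lia.
by move/esym/eqP; rewrite mulf_eq0 invr_eq0 (negPf two_neq0) => /eqP.
Qed.

(** The Miura transform of [s = pade_s k]. By [pade_u_succ] the partner potential [s' - s^2] is
    [pade_u k.+1]. *)
Definition pade_u k := - (d (pade_s k) + pade_s k ^+ 2).

Lemma pade_succ k : (2 * k.+1 < M)%N ->
  pade k.+1 = 2%:R * D (pade k) + 'X * pade k - 2%:R * (pade_s k)%:P * pade k.
Proof.
move=> lt_kM; have /eqP := darboux1 lt_kM (pade_nondeg lt_kM).
rewrite subr_eq => /eqP H; have : 2%:R *: shiftD (pade k) = 2%:R *: (pade_s k *: pade k + 2%:R^-1 *: pade k.+1).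
  by rewrite H.
rewrite /shiftD !scalerDr !scalerA two_half !scale1r => H'.
rewrite -!mul_polyC rmorphM rmorph_nat in H'.
by rewrite -mulrA mulrA H'; ring.
Qed.

Lemma pade_pred k : (2 * k.+1 < M)%N -> 'X^2 * pade k =
  2%:R * D (pade k.+1) + 'X * pade k.+1 + 2%:R * (pade_s k)%:P * pade k.+1.
Proof.
move=> lt_kM; have /eqP := darboux2 lt_kM (pade_nondeg lt_kM).
rewrite subr_eq => /eqP H; have : 2%:R *: shiftD (pade k.+1) = 2%:R *: (- pade_s k *: pade k.+1 + 2%:R^-1 *: ('X^2 * pade k)).
  by rewrite H.
rewrite /shiftD !scalerDr !scalerA two_half !scale1r => H'.
rewrite -!mul_polyC rmorphM rmorphN rmorph_nat in H'.
by rewrite H'; ring.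
Qed.

Lemma two_polyI (p : {poly K}) : 2%:R * p = 0 -> p = 0.
Proof.
move/eqP; rewrite mulf_eq0 -polyC_natr polyC_eq0 (negPf two_neq0) => /eqP.
by [].
Qed.

(* Eliminate [pade k.+1] between the two Darboux relations. *)
Lemma pade_ode k : (2 * k.+1 < M)%N ->
  D (D (pade k)) + 'X * D (pade k) + (pade_u k)%:P * pade k = 0.
Proof.
move=> lt_kM; have H := pade_pred lt_kM.
rewrite (pade_succ lt_kM) in H.
rewrite !(der_natl derD, der_sub derD, der_add derD, der_mul derD) in H.
rewrite !dcoefC ?dcoefX // in H.
apply/two_polyI/two_polyI; apply/eqP; rewrite -(subrr ('X^2 * pade k)) {1}H /pade_u.
by rewrite !(polyCN, polyCD, polyC_exp); apply/eqP; ring.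
Qed.

Lemma pade_u0 : (2 < M)%N -> pade_u 0 = 0.
Proof.
move=> lt2M; have := @pade_ode 0 lt2M; rewrite pade0 (der1 derD) (der0 derD).
by rewrite mulr0 !add0r mulr1 => /eqP; rewrite polyC_eq0 => /eqP.
Qed.

(** Eliminating [pade k] instead of [pade k.+1] between the Darboux relations yields a second-order
    equation for [pade k.+1]; comparison with [pade_ode] at [k.+1] gives its potential. *)
Lemma pade_u_succ k : (2 * k.+2 < M)%N ->
  pade_u k.+1 = pade_u k + 2%:R * d (pade_s k).
Proof.
move=> lt_kM; have lt_kM' : (2 * k.+1 < M)%N by lia.
have H := pade_pred lt_kM'; have H1 := pade_ode lt_kM.
have /(congr1 ( *%R 'X^2)) H2 := pade_succ lt_kM'.
have DX2 : D ('X^2 * pade k) = 'X^2 * D (pade k).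
  by rewrite !(der_mul derD) dcoefX //; ring.
have DH : 'X^2 * D (pade k) = 2%:R * D (D (pade k.+1)) + 'X * D (pade k.+1)
   + 2%:R * (d (pade_s k))%:P * pade k.+1 + 2%:R * (pade_s k)%:P * D (pade k.+1).
  rewrite -DX2 H !(der_natl derD, der_sub derD, der_add derD, der_mul derD).
  by rewrite !dcoefC ?dcoefX //; ring.
have Z : ((pade_u k.+1)%:P - ((pade_u k)%:P + 2%:R * (d (pade_s k))%:P)) * pade k.+1 = 0.
  rewrite mulrBl.
  have -> : (pade_u k.+1)%:P * pade k.+1 =
    - (D (D (pade k.+1)) + 'X * D (pade k.+1)).
    by apply/eqP; rewrite -addr_eq0 addrC H1.
  apply/two_polyI/two_polyI; rewrite -[RHS](subrr ('X^2 * pade k.+1)) {2}H2 /pade_u.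
  move: (pade_s k) H DH => s H DH.
  rewrite !(polyCN, polyCD, polyC_exp).
  have -> : 'X^2 * (2%:R * D (pade k) + 'X * pade k - 2%:R * s%:P * pade k)
    = 2%:R * ('X^2 * D (pade k)) + 'X * ('X^2 * pade k) -
      2%:R * s%:P * ('X^2 * pade k) by ring.
  rewrite DH H; ring.
move/eqP: Z; rewrite mulf_eq0 (negPf (pade_neq0 _)) orbF subr_eq0.
rewrite -(rmorph_nat (@polyC K)) -polyCM -polyCD => /eqP.
exact: polyC_inj.
Qed.

(** * The product [q_k(w) q_k(-w)] and its first integral *)

Definition pade_sq k := pade k * flip (pade k).

(** The left-hand side is the Wronskian in [x] of [exp(xw/2) q_k(w)] and [exp(-xw/2) q_k(-w)], two
    solutions of [psi'' = (w^2/4 - u_k) psi]. Its value comes from [pade_wronskian] after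
    eliminating [pade k.+1]. *)
Lemma pade_logwronskian k : (2 * k.+1 < M)%N ->
  D (pade k) * flip (pade k) - pade k * flip (D (pade k)) + 'X * pade_sq k =
  (-1) ^+ k *: 'X^((2 * k).+1).
Proof.
move=> lt_kM; have := pade_wronskian lt_kM (pade_nondeg lt_kM).
have -> : flip (pade k.+1) =
    2%:R * flip (D (pade k)) - 'X * flip (pade k) - 2%:R * (pade_s k)%:P * flip (pade k).
  rewrite (pade_succ lt_kM) -mulrA rmorphB rmorphD /= !flip_natl !rmorphM /= flipX flipC.
  by rewrite mulNr mulrA.
rewrite (pade_succ lt_kM).
have -> : ((-1) ^+ k.+1 * 2%:R) *: 'X^((2 * k).+1) =
    - (2%:R * ((-1) ^+ k *: 'X^((2 * k).+1))) :> {poly K}.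
  by rewrite exprS mulN1r mulNr scaleNr [_ * 2%:R]mulrC -scalerA scaler_nat mulr_natl.
move=> H.
apply/eqP; rewrite -subr_eq0; apply/eqP/two_polyI.
rewrite mulrBr -[X in _ - X]opprK -H /pade_sq. ring.
Qed.

(** [S] is the product of the two solutions above. Squaring their Wronskian and removing second
    derivatives by the differential equation leaves an expression in [S], [S'] and [S'']. *)
Lemma pade_sq_quadratic k : (2 * k.+1 < M)%N -> let S := pade_sq k in
  'X^2 * S ^+ 2 = 'X^(4 * k + 2)
    + (2%:R * S * D (D S) - D S ^+ 2 + 4%:R * (pade_u k)%:P * S ^+ 2).
Proof.
move=> lt_kM S; pose q := pade k; pose sq := flip q.
have W := pade_logwronskian lt_kM.
have ode := pade_ode lt_kM.
have sode : flip (D (D q)) - 'X * flip (D q) + (pade_u k)%:P * sq = 0.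
  by have := congr1 (@flip K) ode; rewrite !(rmorphD, rmorphM, rmorph0) /= flipX flipC mulNr.
have DDq : D (D q) = - 'X * D q - (pade_u k)%:P * q.
  by apply/eqP; rewrite -subr_eq0 -[X in _ == X]ode; apply/eqP; ring.
have DDsq : flip (D (D q)) = 'X * flip (D q) - (pade_u k)%:P * sq.
  by apply/eqP; rewrite -subr_eq0 -[X in _ == X]sode; apply/eqP; ring.
have -> : 'X^(4 * k + 2) = ((-1) ^+ k *: 'X^((2 * k).+1)) ^+ 2 :> {poly K}.
  rewrite exprZn -exprM mulnC exprM sqrr_sign scale1r -exprM.
  by congr ('X^_); lia.
rewrite -W /S /pade_sq -/q !(der_mul derD, der_add derD) !dcoef_flip // -/sq.
by rewrite DDsq DDq; ring.
Qed.

Lemma revp_dcoef n r : revp n (D r) = D (revp n r).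
Proof.
apply/polyP=> i; rewrite coef_dcoef // {1}/revp [LHS]coef_poly /revp [in RHS]coef_poly.
by case: ifP => _; rewrite ?coef_dcoef // (der0 der_d).
Qed.

Lemma size_pade_sq k : (size (pade_sq k) <= (2 * k).+1)%N.
Proof.
rewrite (leq_trans (size_polyMleq _ _)) // size_flip !pade_size; lia.
Qed.

Lemma pade_sq_odd k i : odd i -> (pade_sq k)`_i = 0.
Proof.
move=> odd_i; have : flip (pade_sq k) = pade_sq k.
  by rewrite /pade_sq rmorphM /= flipK mulrC.
move/(congr1 (fun p : {poly K} => p`_i)); rewrite coef_flip -signr_odd odd_i.
rewrite expr1 mulN1r => /eqP; rewrite eq_sym -addr_eq0 -mulr2n -mulr_natl.
by rewrite mulf_eq0 (negPf two_neq0) => /eqP.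
Qed.

(* [pade_sq] is even of degree [2k]; in the variable [w^(-2)] it becomes [pade_gen], normalised by [pade_gen0]. *)
Definition pade_gen k :=
  \poly_(i < k.+1) ((-1) ^+ k * (pade_sq k)`_(2 * k - 2 * i)).

Lemma pade_gen_comp k :
  pade_gen k \Po 'X^2 = (-1) ^+ k *: revp (2 * k) (pade_sq k).
Proof.
apply/polyP=> i; rewrite coef_comp_poly_Xn // coefZ dvdn2.
rewrite !coef_poly; case: (boolP (odd i)) => odd_i /=.
  case: ifP => [|_]; rewrite ?mulr0 // => lt_i; rewrite pade_sq_odd ?mulr0 //.
  by rewrite oddB ?odd_i ?oddM //; lia.
have -> : (i %/ 2 < k.+1)%N = (i < (2 * k).+1)%N by lia.
case: ifP => [lt_i|]; rewrite ?mulr0 //; congr (_ * (_)`_ _); lia.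
Qed.

Lemma comp_X2_inj : injective (fun p : {poly K} => p \Po 'X^2).
Proof.
move=> p q /polyP E'; apply/polyP=> i; have := E' (2 * i)%N.
by rewrite !coef_comp_poly_Xn // dvdn_mulr // mulKn.
Qed.

Lemma dcoef_comp_X2 p : D p \Po 'X^2 = D (p \Po 'X^2).
Proof.
apply/polyP=> i; rewrite coef_dcoef // !coef_comp_poly_Xn // coef_dcoef //.
by case: ifP; rewrite // (der0 der_d).
Qed.

Lemma revp_quadratic n (P : {poly K}) u : (size P <= n.+1)%N ->
    'X^2 * P ^+ 2 = 'X^(2 + (n + n))
      + (2%:R * P * D (D P) - D P ^+ 2 + 4%:R * u%:P * P ^+ 2) ->
  let S := revp n P in
  S ^+ 2 = 1 + 'X^2 * (2%:R * S * D (D S) - D S ^+ 2 + 4%:R * u%:P * S ^+ 2).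
Proof.
move=> sz EP S.
have sz2 (p q : {poly K}) : (size p <= n.+1)%N -> (size q <= n.+1)%N ->
    (size (p * q)%R <= (n + n).+1)%N.
  move=> sz_p sz_q; rewrite (leq_trans (size_polyMleq _ _)) //; lia.
have szD (p : {poly K}) : (size p <= n.+1)%N -> (size (D p) <= n.+1)%N.
  exact/leq_trans/size_dcoef.
have szC c (p : {poly K}) : (size p <= (n + n).+1)%N ->
    (size (c%:P * p)%R <= (n + n).+1)%N.
  by move=> sz_p; rewrite mul_polyC (leq_trans (size_scale_leq _ _)).
pose B := 2%:R * (P * D (D P)) - D P * D P + 4%:R * (u%:P * (P * P)).
have szB : (size B <= (n + n).+1)%N.
  rewrite (leq_trans (size_polyD _ _)) // geq_max.
  rewrite (leq_trans (size_polyD _ _)) // ?geq_max ?size_polyN.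
    by rewrite -!polyC_natr !szC // sz2 // ?szD.
  by rewrite -!polyC_natr !szC ?sz2 ?szD.
have revC c (p : {poly K}) m : revp m (c%:P * p) = c%:P * revp m p.
  by rewrite !mul_polyC linearZ.
have revB : revp (n + n) B = 2%:R * (S * D (D S)) - D S * D S + 4%:R * (u%:P * (S * S)).
  rewrite linearD linearB /= -!polyC_natr !revC !revpM ?szD //.
  by rewrite !revp_dcoef.
(* At formal degree 2, reversal exchanges the factors ['X^2] and [1]; this moves the power of [w]
   from the left-hand side to the bracket. *)
have EB : P * P * 'X^2 = 'X^(n + n + 2) + B * 1.
  by rewrite mulrC -expr2 EP /B [(n + n + 2)%N]addnC; ring.
have := congr1 (revp (n + n + 2)) EB.
rewrite raddfD /= !revpM ?size_polyXn ?size_poly1 ?sz2 // revB !revpXn //.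
have rev1 : revp 2 1 = 'X^2 :> {poly K} by rewrite -(expr0 'X) revpXn.
by rewrite rev1 !subnn expr0 mulr1 => SS; rewrite [LHS]expr2 [LHS]SS; ring.
Qed.

Lemma comp_X2_quadratic (L : {poly K}) a b u : let S := L \Po 'X^2 in
  (1 + 'X * (a%:P * L * D (D L) - D L ^+ 2 + b%:P * u%:P * L ^+ 2)) \Po 'X^2 =
  1 + 'X^2 * (a%:P * S * D (D S) - D S ^+ 2 + b%:P * u%:P * S ^+ 2).
Proof.
rewrite /= -!dcoef_comp_X2.
rewrite !(rmorphD, rmorphN, rmorphM, rmorphXn, rmorph1) /= !comp_polyC.
by rewrite comp_polyX.
Qed.

Lemma pade_gen_quadratic k : (2 * k.+1 < M)%N -> let L := pade_gen k in
  L ^+ 2 = 1 + 'X * (2%:R * L * D (D L) - D L ^+ 2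
                     + 4%:R * (pade_u k)%:P * L ^+ 2).
Proof.
move=> lt_kM L; apply: comp_X2_inj.
rewrite -(polyC_natr _ 2) -(polyC_natr _ 4) comp_X2_quadratic rmorphXn /=.
rewrite pade_gen_comp !polyC_natr.
have H := pade_sq_quadratic lt_kM.
rewrite (_ : 4 * k + 2 = 2 + (2 * k + 2 * k))%N in H; last by lia.
move: (revp_quadratic (size_pade_sq k) H) => /=; move: (revp _ _) => S SS.
have dS c p : d c = 0 -> D (c *: p) = c *: D p.
  by move=> dc0; rewrite -!mul_polyC (der_mul derD) dcoefC // dc0 mul0r add0r.
rewrite !dS ?(der_sign der_d) //.
have sgn2 : ((-1) ^+ k)%:P ^+ 2 = 1 :> {poly K} by rewrite -polyC_exp sqrr_sign.
rewrite -!mul_polyC; move: sgn2; set c := _%:P => sgn2.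
transitivity (c ^+ 2 * (S * S)); first by ring.
rewrite sgn2 mul1r -expr2 [LHS]SS.
transitivity (1 + 'X^2 * (c ^+ 2 * (2%:R * S * D (D S) - D S ^+ 2 +
  4%:R * (pade_u k)%:P * S ^+ 2))); [by rewrite sgn2 mul1r | ring].
Qed.

Lemma coef_pade_gen k i : (i <= k)%N ->
  (pade_gen k)`_i = (-1) ^+ k * (pade_sq k)`_(2 * (k - i)).
Proof. by move=> le_ik; rewrite coef_poly ltnS le_ik mulnBr. Qed.

Lemma coefM_top m n (p q : {poly K}) : (size p <= m.+1)%N ->
  (size q <= n.+1)%N -> (p * q)`_(m + n) = p`_m * q`_n.
Proof.
move=> sz_p sz_q; have := congr1 (fun r : {poly K} => r`_0) (revpM sz_p sz_q).
by rewrite coef_revp // subn0 => ->; rewrite coefM big_ord1 !coef_revp // !subn0.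
Qed.

Lemma pade_gen0 k : (pade_gen k)`_0 = 1.
Proof.
rewrite coef_pade_gen // subn0 mul2n -addnn coefM_top ?size_flip ?pade_size //.
by rewrite coef_flip !pade_size mul1r mulr1 -expr2 sqrr_sign.
Qed.

(* Multiply the [w]-derivative of the Pade relation by [pade k]: at order [2k] only the leading term of the defect survives. *)
Lemma pade_contour (V : {poly K}) k : (2 * k.+1 < M)%N ->
    'X^(M.-1) %| E^`() - V * E ->
  (V * pade_sq k)`_(2 * k) = (2 * k).+1%:R * eps k * pade_const k.
Proof.
move=> lt_kM EV.
have ord_k : 'X^((2 * k).+1) %| defect (pade k).
  by apply: pade_order; [lia | apply: pade_nondeg; lia].
pose q := pade k; pose e := defect q.
have He : q * E = flip q + e by rewrite /e /defect addrC subrK.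
have := congr1 (@deriv K) He; rewrite derivD !derivM deriv_flip => /(congr1 ( *%R q)).
rewrite mulrDr [q * (q^`() * E)]mulrCA He => Hd.
have eq1 : V * pade_sq k = q * e^`() - q^`() * e - V * q * e
   - (q * flip q^`() + q^`() * flip q) - q * q * (E^`() - V * E).
  rewrite /pade_sq -/q.
  have -> : q * q * (E^`() - V * E) = q * (q * E^`()) - V * q * (q * E) by ring.
  rewrite (canRL (addKr _) Hd) He; ring.
have low : (q * flip q^`() + q^`() * flip q)`_(2 * k) = 0.
  have sz_q : size q = k.+1 by rewrite pade_size.
  have sz_q' : (size q^`() <= k)%N by rewrite -ltnS -sz_q lt_size_deriv ?pade_neq0.
  rewrite nth_default // (leq_trans (size_polyD _ _)) // geq_max.
  by apply/andP; split; rewrite (leq_trans (size_polyMleq _ _)) //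
    ?size_flip sz_q; lia.
have eps0 r : (r * e)`_(2 * k) = 0 by apply: (dvdXnP _ _ (dvdp_mull _ ord_k)).
rewrite eq1 4!coefB low !eps0 (dvdXnP _ _ (dvdp_mull _ EV)) ?subr0; last by lia.
rewrite [q * _]mulrC coef_dvdXnM; last exact: dvdXn_deriv ord_k.
by rewrite coef_deriv -/(lead_defect k q) -/(eps k) mulr_natl.
Qed.

(** The vector is [(q_(k+1) + w q_k) / b_(k+1)]. Multiplied by [E], it is a combination of defects
    plus [q_(k+1)(-w) + w q_k(-w)], whose leading terms cancel, so that in degrees [k+1] to [2k+2]
    only [w] times the defect of [q_k] remains. *)
Lemma pade_hankel_vector k : (2 * k.+1 < M)%N ->
  exists2 r : {poly K}, (size r <= k.+2)%N & [/\ r`_0 = 1,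
    forall j, (k.+1 <= j < 2 * k.+1)%N -> (r * E)`_j = 0 &
    (r * E)`_(2 * k.+1) = eps k / pade_const k.+1].
Proof.
move=> lt_kM; have nd := pade_nondeg lt_kM.
have ord0 : 'X^((2 * k).+1) %| defect (pade k).
  by apply: pade_order; [lia | apply: pade_nondeg; lia].
have ord1 := pade_order lt_kM nd; have b0 := pade_const_neq0 nd.
exists ((pade_const k.+1)^-1 *: (pade k.+1 + 'X * pade k)).
  rewrite (leq_trans (size_scale_leq _ _)) // (leq_trans (size_polyD _ _)) //.
  rewrite geq_max pade_size leqnn (leq_trans (size_polyMleq _ _)) //.
  by rewrite size_polyX pade_size.
have rE j : (k.+1 <= j <= 2 * k.+1)%N ->
    ((pade k.+1 + 'X * pade k) * E)`_j = ('X * defect (pade k))`_j.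
  move=> /andP[ge_j le_j].
  have -> : (pade k.+1 + 'X * pade k) * E =
      'X * defect (pade k) + (flip (pade k.+1) + 'X * flip (pade k))
      + defect (pade k.+1) by rewrite /defect; ring.
  rewrite 2!coefD [(defect (pade k.+1))`_j](dvdXnP _ _ ord1) // addr0.
  rewrite [X in _ + X](_ : _ = 0) ?addr0 // coefD coefXM.
  case: j ge_j {le_j} => // j; rewrite /= ltnS leq_eqVlt => /predU1P[<-|lt_kj].
    by rewrite !coef_flip !pade_size exprS; ring.
  by rewrite !nth_default ?addr0 // size_flip pade_size.
split=> [|j /andP[ge_j lt_j]|].
- by rewrite coefZ coefD coefXM addr0 mulVf.
- have le_j : (k.+1 <= j <= 2 * k.+1)%N by rewrite ge_j ltnW.
  rewrite -scalerAl coefZ rE // coefXM.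
  by case: j ge_j lt_j {le_j} => // j _ lt_j; rewrite (dvdXnP _ _ ord0) ?mulr0 //=; lia.
have le_j : (k.+1 <= 2 * k.+1 <= 2 * k.+1)%N by lia.
rewrite -scalerAl coefZ rE //.
rewrite coefXM mulnS /= -/(lead_defect k _) -/(eps k) mulrC.
by [].
Qed.
End Darboux.
End Pade.

(** * Hankel determinants *)

Section HankelDeterminant.
Variables (K : fieldType) (E r : {poly K}) (k : nat).
Hypotheses (size_r : (size r <= k.+2)%N) (r0 : r`_0 = 1).
Hypothesis rE0 : forall j, (k.+1 <= j < 2 * k.+1)%N -> (r * E)`_j = 0.

Definition hankel n : 'M[K]_n := \matrix_(i, j) E`_(i + j).

(** The last column is replaced by the combination of columns with the reversed coefficients of [r].
    This is multiplication by the unitriangular matrix [C], as [r_0 = 1]; by [rE0] only the bottom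
    entry of the new column survives. *)
Lemma det_hankelS :
  \det (hankel k.+2) = (r * E)`_(2 * k.+1) * \det (hankel k.+1).
Proof.
have happ (i : 'I_k.+2) :
    \sum_j hankel k.+2 i j * r`_(k.+1 - j) = (r * E)`_(k.+1 + i).
  rewrite coefM (reindex_inj rev_ord_inj) /=.
  rewrite -(big_mkord xpredT (fun j => r`_j * E`_(k.+1 + i - j))).
  rewrite (big_cat_nat (n := k.+2)) //=; last by rewrite ltnS leq_addr.
  rewrite [X in _ = _ + X]big_nat_cond [X in _ = _ + X]big1 ?addr0; last first.
    by move=> j /andP[/andP[ge_j _] _]; rewrite nth_default ?mul0r // (leq_trans size_r).
  rewrite big_mkord; apply: eq_bigr => j _; have lt_j := ltn_ord j.
  by rewrite mxE mulrC; congr (r`_ _ * E`_ _); rewrite /=; lia.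
pose C : 'M[K]_k.+2 :=
  \matrix_(i, j) if j == ord_max then r`_(k.+1 - i) else (i == j)%:R.
have detC : \det C = 1.
  rewrite -det_tr det_trig.
    rewrite big1 // => i _; rewrite !mxE eqxx; case: eqP => // ->.
    by rewrite subnn.
  apply/is_trig_mxP=> i j lt_ij; rewrite !mxE.
  rewrite ifN; last by rewrite -val_eqE /=; have := ltn_ord j; lia.
  by rewrite -val_eqE /= gtn_eqF.
have HC i j : (hankel k.+2 *m C) i j =
    if j == ord_max then (r * E)`_(k.+1 + i) else hankel k.+2 i j.
  rewrite mxE; case: (eqVneq j ord_max) => [->|ne_j].
    by rewrite -happ; apply: eq_bigr => l _; rewrite [C _ _]mxE eqxx.
  rewrite (bigD1 j) //= big1 ?addr0 => [|l ne_lj].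
    by rewrite [C _ _]mxE (negPf ne_j) eqxx mulr1.
  by rewrite [C _ _]mxE (negPf ne_j) (negPf ne_lj) mulr0.
rewrite -[LHS]mulr1 -detC -det_mulmx (expand_det_col _ ord_max).
rewrite (bigD1 ord_max) //= big1 ?addr0 => [|i ne_i].
  rewrite HC eqxx /= addnn -mul2n; congr (_ * _).
  rewrite /cofactor /= addnn -signr_odd odd_double expr0 mul1r; congr (\det _).
  apply/matrixP=> i j; rewrite mxE mxE HC ifN; last by rewrite eq_sym neq_lift.
  by rewrite !mxE !lift_max.
rewrite HC eqxx rE0 ?mul0r //; move: ne_i; rewrite -val_eqE /=.
have := ltn_ord i; lia.
Qed.
End HankelDeterminant.

(** * Differentiation of rational functions *)

Section QuotientRule.
Variables (L : fieldType) (p q a b : L).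
Hypotheses (q0 : q != 0) (b0 : b != 0).

Lemma div_sqr_eq x y : x * q ^+ 2 = y * b ^+ 2 -> x / b ^+ 2 = y / q ^+ 2.
Proof. by move/eqP; rewrite -eqr_div ?expf_neq0 // => /eqP. Qed.

Lemma cross_mul : p / q = a / b -> p * b = a * q.
Proof. by move=> E; rewrite -[p](divfK q0) E mulrAC divfK. Qed.

End QuotientRule.

(* The morphism is kept abstract: with [tofrac] in its place, conversion unfolds polynomial products. *)
Section QuotientRuleMorphism.
Variables (A : comPzRingType) (L : fieldType) (phi : {rmorphism A -> L}).
Variables (p q a b p' q' a' b' : A).
Hypotheses (q0 : phi q != 0) (b0 : phi b != 0).

Lemma morph_addf_div :
  phi p / phi q + phi a / phi b = phi (p * b + a * q) / phi (q * b).
Proof. by rewrite rmorphD !rmorphM addf_div. Qed.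

Lemma morph_mulf_div :
  phi p / phi q * (phi a / phi b) = phi (p * a) / phi (q * b).
Proof. by rewrite !rmorphM mulf_div. Qed.

Lemma quotient_ruleD :
  phi ((p' * b + p * b' + (a' * q + a * q')) * (q * b) -
    (p * b + a * q) * (q' * b + q * b')) / phi (q * b) ^+ 2 =
  phi (p' * q - p * q') / phi q ^+ 2 + phi (a' * b - a * b') / phi b ^+ 2.
Proof.
by rewrite !(rmorphB, rmorphD, rmorphM); field; rewrite q0 b0.
Qed.

Lemma quotient_ruleM :
  phi ((p' * a + p * a') * (q * b) - p * a * (q' * b + q * b')) /
    phi (q * b) ^+ 2 =
  phi (p' * q - p * q') / phi q ^+ 2 * (phi a / phi b) +
  phi p / phi q * (phi (a' * b - a * b') / phi b ^+ 2).
Proof.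
by rewrite !(rmorphB, rmorphD, rmorphM); field; rewrite q0 b0.
Qed.

End QuotientRuleMorphism.

Section RationalDerivation.
Variable F : fieldType.
Notation K := {fraction {poly F}}.

Lemma tofrac_inj : injective (@FracField.tofrac {poly F}).
Proof. by move=> p q /eqP; rewrite tofrac_eq => /eqP. Qed.

Lemma repr_fracE (r : K) : r = (\n_(repr r))%:F / (\d_(repr r))%:F.
Proof.
have d0 := denom_ratioP (repr r).
suff H : r * (\d_(repr r))%:F = (\n_(repr r))%:F.
  by rewrite -H mulfK // tofrac_eq0.
rewrite -{1}[r]reprK; move: (repr r) d0 => x d0.
rewrite /FracField.tofrac; unlock; rewrite -[LHS]/(FracField.mul _ _) piE.
apply/eqmodP; rewrite /= FracField.equivfE /FracField.mulf.
by rewrite !numden_Ratio ?mulf_neq0 ?oner_neq0 //; apply/eqP; ring.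
Qed.

Lemma fracP (r : K) : exists p q : {poly F}, q != 0 /\ r = p%:F / q%:F.
Proof.
by exists \n_(repr r), \d_(repr r); rewrite -repr_fracE denom_ratioP.
Qed.

Lemma frac_sqr_eq (x y a b : {poly F}) : a != 0 -> b != 0 ->
  x * a ^+ 2 = y * b ^+ 2 -> x%:F / b%:F ^+ 2 = y%:F / a%:F ^+ 2.
Proof.
move=> a0 b0 E; apply: div_sqr_eq; rewrite ?tofrac_eq0 //.
by rewrite !expr2 -!tofracM -!expr2 E.
Qed.

(** [ratderiv] is defined on the representative picked by [repr]; this is the independence of that
    choice, from which the derivation rules follow. *)
Lemma ratderiv_frac (p q : {poly F}) : q != 0 ->
  ratderiv (p%:F / q%:F) = (p^`() * q - p * q^`())%:F / q%:F ^+ 2.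
Proof.
move=> q0; rewrite /ratderiv.
move: (denom_ratioP (repr (p%:F / q%:F))) (repr_fracE (p%:F / q%:F)).
move: \n_(repr _) \d_(repr _) => a b b0 E.
have [q0F b0F] : q%:F != 0 /\ b%:F != 0 by rewrite !tofrac_eq0.
have pb : p * b = a * q.
  have pbF := cross_mul q0F b0F E.
  apply: tofrac_inj.
  by rewrite 2!tofracM.
have dpb : p^`() * b + p * b^`() = a^`() * q + a * q^`() by rewrite -!derivM pb.
apply: frac_sqr_eq => //; apply/eqP; rewrite -subr_eq0.
(* The difference is a combination of the cross-multiplied equality [pb = aq] and its derivative. *)
have -> : (a^`() * b - a * b^`()) * q ^+ 2 - (p^`() * q - p * q^`()) * b ^+ 2 =
  q * b * (a^`() * q + a * q^`() - (p^`() * b + p * b^`()))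
  - (q^`() * b + q * b^`()) * (a * q - p * b) by ring.
by rewrite dpb pb !subrr !mulr0 subrr.
Qed.

Lemma ratderiv_derivation : is_derivation (@ratderiv F).
Proof.
split=> r s; have [p [q [q0 ->]]] := fracP r; have [a [b [b0 ->]]] := fracP s.
all: have [q0F b0F] : q%:F != 0 /\ b%:F != 0 by rewrite !tofrac_eq0.
  rewrite (morph_addf_div _ _ q0F b0F) !ratderiv_frac ?mulf_neq0 //.
  rewrite derivD.
  rewrite !derivM.
  exact: (quotient_ruleD _ _ _ _ _ _ q0F b0F).
rewrite morph_mulf_div !ratderiv_frac ?mulf_neq0 //.
rewrite !derivM.
  exact: (quotient_ruleM _ _ _ _ _ _ q0F b0F).
Qed.

Lemma ratderiv_poly (p : {poly F}) : ratderiv p%:F = (p^`())%:F.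
Proof.
have {1}-> : p%:F = p%:F / 1%:F by rewrite tofrac1 divr1.
rewrite ratderiv_frac ?oner_neq0 // tofrac1 expr1n divr1.
by rewrite derivC mulr0 subr0 mulr1.
Qed.

(** The polynomial ring is integrally closed. The members of the recurrence are seen to be
    polynomials because their squares are. *)
Lemma frac_sqr_poly (r : K) (p : {poly F}) : r ^+ 2 = p%:F ->
  exists q : {poly F}, q%:F = r.
Proof.
have [a [b [b0 ->]]] := fracP r; have bF : b%:F != 0 by rewrite tofrac_eq0.
rewrite expr_div_n => /(canRL (mulfVK (expf_neq0 2 bF)))/eqP.
rewrite -!tofracXn -tofracM tofrac_eq => /eqP E.
have : b ^+ 2 %| a ^+ 2 by rewrite E dvdp_mull.
rewrite dvdp_pexp2r // => /dvdpP[q ->].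
by exists q; rewrite tofracM mulfK.
Qed.

End RationalDerivation.

(** * The quadratic form of the Lenard recursion *)

(* If [P] is the generating function of a sequence [c] with [2 c_0 = 1], then [c] satisfies the Lenard recursion as soon
   as [qform P] is constant, because its derivative is [2 P * lenard_defect P]. *)
Section QuadraticRecursion.
Variables (A : comNzRingType) (D : A -> A) (derD : is_derivation D) (u : A).
Implicit Types P R W : {poly A}.
Local Notation d := (dcoef D).
Let dX := dcoef_derivation derD.

Definition qform P :=
  P ^+ 2 - 'X * (2%:R * P * d (d P) - d P ^+ 2 + 4%:R * u%:P * P ^+ 2).

Definition lenard_defect P :=
  d P - 'X * (d (d (d P)) + 4%:R * u%:P * d P + 2%:R * (D u)%:P * P).

Lemma dcoef_qform P : d (qform P) = 2%:R * P * lenard_defect P.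
Proof.
rewrite /qform /lenard_defect.
rewrite !(der_natl dX, der_sub dX, der_add dX, der_exp dX, der_mul dX).
rewrite !dcoefC // !dcoefX //=. ring.
Qed.

(** In the coefficient of order [j] of [2 P * lenard_defect P], all earlier coefficients of the
    defect vanish by induction, and the remaining one is multiplied by [2 P_0 = 1]. *)
Lemma qform_lenard P n : 2%:R * P`_0 = 1 ->
  (forall j, (j <= n)%N -> D (qform P)`_j = 0) ->
  forall j, (j <= n)%N -> (lenard_defect P)`_j = 0.
Proof.
move=> P0 q0; elim/ltn_ind => j IHj le_jn.
have := q0 j le_jn; rewrite -coef_dcoef // dcoef_qform coefM big_ord_recl /=.
rewrite big1 => [|i _].
  by rewrite subn0 addr0 -polyC_natr coefCM P0 mul1r.
by rewrite IHj ?mulr0 // /bump /=; have := ltn_ord i; lia.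
Qed.

Lemma qform_add P W : qform (P + W) = qform P + W * (2%:R * P + W)
  - 'X * (2%:R * (P * d (d W) + W * d (d P) + W * d (d W)) - d W * (2%:R * d P + d W)
    + 4%:R * u%:P * W * (2%:R * P + W)).
Proof. by rewrite /qform !(der_add dX); ring. Qed.

Lemma qform_addXn P W n : qform (P + W * 'X^n) = qform P
  + W * (2%:R * P + W * 'X^n) * 'X^n
  - (2%:R * (P * d (d W) + W * d (d P) + W * 'X^n * d (d W)) - d W * (2%:R * d P + d W * 'X^n)
    + 4%:R * u%:P * W * (2%:R * P + W * 'X^n)) * 'X^(n.+1).
Proof. by rewrite qform_add !dcoef_mulXn // exprS; ring. Qed.

(** A perturbation of order [n] is visible up to that order only at [n], and there linearly. This
    serves both to prove uniqueness in [qform_inj] and to solve for the next coefficient in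
    [quadratic_recursion_aux]. *)
Lemma coef_qform_addXn P W n j : (0 < n)%N -> (j <= n)%N ->
  (qform (P + W * 'X^n))`_j = (qform P)`_j + (2%:R * P`_0 * W`_0) *+ (j == n).
Proof.
move=> n_gt0 le_jn; rewrite qform_addXn coefB coefD !coefMXn ltnS le_jn subr0.
congr (_ + _); have [->|ne_jn] := eqVneq j n; last first.
  by rewrite ifT // ltn_neqAle ne_jn.
rewrite ltnn subnn coefM big_ord1 coefD coefMXn n_gt0 addr0 -polyC_natr coefCM.
by rewrite mulrC mulr1n.
Qed.

Lemma qform_inj P R n : 2%:R * P`_0 = 1 -> P`_0 = R`_0 ->
  (forall j, (j <= n)%N -> (qform P)`_j = (qform R)`_j) ->
  forall j, (j <= n)%N -> P`_j = R`_j.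
Proof.
move=> P0 PR0 EPR; elim/ltn_ind => -[|j] IHj le_jn //.
pose W := drop_poly j.+1 (R - P).
have ER : R = P + W * 'X^(j.+1).
  rewrite -[LHS](subrK P) addrC; congr (_ + _).
  rewrite -[LHS](poly_take_drop j.+1) (_ : take_poly _ _ = 0) ?add0r //.
  apply/polyP=> i; rewrite coef_take_poly coef0; case: ifP => // lt_ij.
  by rewrite coefB IHj ?subrr //; lia.
have := EPR _ le_jn; rewrite ER coef_qform_addXn // eqxx P0 mul1r mulr1n.
move/esym/(canRL (addKr _)); rewrite addNr coefD coefMXn ltnn subnn => ->.
by rewrite addr0.
Qed.

End QuadraticRecursion.

(** * Differential polynomials *)

Lemma sum_leibniz (A : pzRingType) (I : Type) (r : seq I) (f f1 f2 : I -> A) a b :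
  (forall i, f i = f1 i * b + a * f2 i) ->
  \sum_(i <- r) f i = (\sum_(i <- r) f1 i) * b + a * \sum_(i <- r) f2 i.
Proof.
by move=> E; rewrite mulr_suml mulr_sumr -big_split; apply: eq_bigr => i _.
Qed.

(** Each equation is asked for only at positive multiplicity, because the quotient of a monomial by
    [u_i] is exact only when [u_i] occurs in it. *)
Lemma mulrn_leibniz (A : pzRingType) (x y z a b : A) m n :
  ((0 < m)%N -> x = y * b) -> ((0 < n)%N -> x = a * z) ->
  x *+ (m + n) = y *+ m * b + a * (z *+ n).
Proof.
move=> Hm Hn; rewrite mulrnDr mulrnAl mulrnAr; congr (_ + _).
  by case: m Hm => // m ->.
by case: n Hn => // n ->.
Qed.

Lemma derivation_ext (A : pzRingType) (D : A -> A) (S : A -> Prop) :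
    {morph D : x y / x + y} ->
    (forall T : A -> Prop, T 0 -> (forall x y, T x -> T y -> T (x + y)) ->
       (forall x, S x -> T x) -> forall x, T x) ->
    (forall x y, S x -> S y -> D (x * y) = D x * y + x * D y) ->
  is_derivation D.
Proof.
move=> DD ind Dmul; split=> // x y.
have D0 : D 0 = 0 by apply: (addrI (D 0)); rewrite -DD !addr0.
apply: (ind (fun x => D (x * y) = D x * y + x * D y)).
- by rewrite D0 !mul0r D0 addr0.
- by move=> a b Ha Hb; rewrite mulrDl !DD Ha Hb !mulrDl addrACA.
move=> {}x Sx; apply: (ind (fun y => D (x * y) = D x * y + x * D y)) y.
- by rewrite D0 !mulr0 D0 addr0.
- by move=> a b Ha Hb; rewrite mulrDr !DD Ha Hb !mulrDr addrACA.
- by move=> y; apply: Dmul.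
Qed.

Lemma term_leibniz (A : comPzRingType) (D : A -> A) (a b ab x y xy dx dy dxy : A) :
  D (a * x) = a * dx -> D (b * y) = b * dy -> D (ab * xy) = ab * dxy ->
  ab = a * b -> xy = x * y -> dxy = dx * y + x * dy ->
  D (a * x * (b * y)) = D (a * x) * (b * y) + a * x * D (b * y).
Proof.
move=> -> -> Dab Eab Exy Edxy; rewrite mulrACA -Eab -Exy Dab Edxy Eab; ring.
Qed.

Section DifferentialPolynomialDerivation.
Variable F : fieldType.

(* Locking [monX] and [dmonom] prevents unification from unfolding products of differential polynomials. *)
Fact monX_key : unit. Proof. by []. Qed.
Definition monX (m : {cmonom nat}) : diffpoly F := locked_with monX_key << m >>.

Lemma monXE m : monX m = << m >>.
Proof. by rewrite /monX unlock. Qed.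

Lemma malgU_monX c m : << c *g m >> = c%:MP * monX m :> diffpoly F.
Proof. by rewrite monXE malgM_def fgmulUU mulr1 mul1m. Qed.

Lemma monXM m1 m2 : monX (mulcm m1 m2) = monX m1 * monX m2.
Proof. by rewrite !monXE malgM_def fgmulUU mulr1. Qed.

Fact dmonom_key : unit. Proof. by []. Qed.
Definition dmonom (m : {cmonom nat}) : diffpoly F := locked_with dmonom_key
  (\sum_(i <- finsupp m) monX (mulcm (divcm m (ucm i)) (ucm i.+1)) *+ m i).

Lemma dmonomE (d : {fset nat}) (m : {cmonom nat}) : (finsupp m `<=` d)%fset ->
  dmonom m = \sum_(i <- d) monX (mulcm (divcm m (ucm i)) (ucm i.+1)) *+ m i.
Proof.
move=> le_md; rewrite /dmonom unlock; apply: big_fset_incl => // i _.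
by rewrite -cmE_eq0 => /eqP->; rewrite mulr0n.
Qed.

Lemma dtotalE (P : diffpoly F) : dtotal P = mmap (@malgC _ F) dmonom P.
Proof.
rewrite /dtotal mmapE; apply: eq_bigr => m _; rewrite (dmonomE (fsubset_refl _)).
rewrite mulr_sumr; apply: eq_bigr => i _.
by rewrite malgU_monX raddfMn /= mulrnAl mulrnAr.
Qed.

Lemma divcmM (m1 m2 : {cmonom nat}) i : (0 < m1 i)%N ->
  mulcm (divcm (mulcm m1 m2) (ucm i)) (ucm i.+1) =
  mulcm (mulcm (divcm m1 (ucm i)) (ucm i.+1)) m2.
Proof.
move=> m1i; apply/eqP/cmP=> j; rewrite !(mulcmE, divcmE, ucmE).
have [<-|_] := eqVneq i j; last by rewrite !subn0 addnAC.
by rewrite gtn_eqF // !addn0 addnBAC.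
Qed.

Lemma dmonomM m1 m2 :
  dmonom (mulcm m1 m2) = dmonom m1 * monX m2 + monX m1 * dmonom m2.
Proof.
pose d := (finsupp m1 `|` finsupp m2)%fset.
rewrite (@dmonomE d) ?mdomD // (@dmonomE d m1) ?fsubsetUl //.
rewrite (@dmonomE d m2) ?fsubsetUr //.
apply: sum_leibniz => i; rewrite (mulcmE m1 m2 i); apply: mulrn_leibniz => mi.
  by rewrite divcmM // monXM.
by rewrite (mulcmC m1 m2) divcmM // (mulcmC _ m1) monXM.
Qed.

Lemma dtotal_is_additive (P Q : diffpoly F) : dtotal (P + Q) = dtotal P + dtotal Q.
Proof. by rewrite !dtotalE raddfD. Qed.

Lemma dtotalU c m : dtotal (c%:MP * monX m) = c%:MP * dmonom m.
Proof. by rewrite -malgU_monX dtotalE mmapU. Qed.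

Lemma malg_sumE (P : diffpoly F) : P = \sum_(m <- msupp P) (P@_m)%:MP * monX m.
Proof. by rewrite {1}(monalgE P); apply: eq_bigr => m _; rewrite malgU_monX. Qed.

Inductive is_term : diffpoly F -> Prop := IsTerm c m : is_term (c%:MP * monX m).

Lemma malg_ind (T : diffpoly F -> Prop) : T 0 ->
  (forall P Q, T P -> T Q -> T (P + Q)) ->
  (forall P, is_term P -> T P) -> forall P, T P.
Proof. by move=> T0 TD TU P; rewrite (malg_sumE P); apply: big_ind => // m _; exact: TU (IsTerm _ _). Qed.

Lemma dtotal0 : dtotal (0 : diffpoly F) = 0.
Proof. by rewrite dtotalE raddf0. Qed.

Lemma malgCM c1 c2 : (c1 * c2)%:MP = c1%:MP * c2%:MP :> diffpoly F.
Proof. exact: rmorphM. Qed.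

Lemma dtotal_termM c1 c2 m1 m2 (P := c1%:MP * monX m1) (Q := c2%:MP * monX m2) :
  dtotal (P * Q) = dtotal P * Q + P * dtotal Q.
Proof.
exact: (term_leibniz (dtotalU c1 m1) (dtotalU c2 m2)
  (dtotalU (c1 * c2) (mulcm m1 m2)) (malgCM c1 c2) (monXM m1 m2) (dmonomM m1 m2)).
Qed.

Lemma dtotal_derivation : is_derivation (@dtotal F).
Proof.
apply: (derivation_ext dtotal_is_additive malg_ind) => _ _ [c1 m1] [c2 m2].
exact: dtotal_termM.
Qed.

End DifferentialPolynomialDerivation.

Lemma rmorph_addM (A B : pzRingType) (f : {rmorphism A -> B}) a b c e :
  f (a * b + c * e) = f a * f b + f c * f e.
Proof. by rewrite rmorphD !rmorphM. Qed.

Lemma intertwine_add (A B : pzRingType) (f : A -> B) (D : A -> A) (d : B -> B) x y :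
  f (D x) = d (f x) -> f (D y) = d (f y) -> D (x + y) = D x + D y ->
  (forall a b, f (a + b) = f a + f b) -> (forall a b, d (a + b) = d a + d b) ->
  f (D (x + y)) = d (f (x + y)).
Proof. by move=> Hx Hy -> fD dD; rewrite !fD dD Hx Hy. Qed.

(** * Evaluation as a differential ring morphism *)

Section Evaluation.
Variables (F : fieldType) (u : {fraction {poly F}}).
Notation K := {fraction {poly F}}.
Notation d := (@ratderiv F).

Definition evalmon (m : {cmonom nat}) : K := \prod_(i <- finsupp m) iter i d u ^+ m i.

Lemma evalmonE (s : {fset nat}) (m : {cmonom nat}) : (finsupp m `<=` s)%fset ->
  evalmon m = \prod_(i <- s) iter i d u ^+ m i.
Proof.
move=> le_ms; apply: big_fset_incl => // i _.
by rewrite -cmE_eq0 => /eqP->; rewrite expr0.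
Qed.

Lemma evalmonM m1 m2 : evalmon (mulcm m1 m2) = evalmon m1 * evalmon m2.
Proof.
pose s := (finsupp m1 `|` finsupp m2)%fset.
rewrite (@evalmonE s) ?mdomD // (@evalmonE s m1) ?fsubsetUl //.
rewrite (@evalmonE s m2) ?fsubsetUr // -big_split /=; apply: eq_bigr => i _.
by rewrite mulcmE exprD.
Qed.

Lemma evalmon1 : evalmon (onecm _) = 1.
Proof. by rewrite /evalmon (@mdom1 nat) big_seq_fset0. Qed.

Lemma evalmonU i : evalmon (ucm i) = iter i d u.
Proof. by rewrite /evalmon mdomU big_seq_fset1 cmUU expr1. Qed.

Fact evalmon_mmorphism : mmorphism evalmon.
Proof. by split; [exact: evalmonM | exact: evalmon1]. Qed.

HB.instance Definition _ := monalg.isMultiplicative.Build _ _ evalmon evalmon_mmorphism.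

Definition polyCF (c : F) : K := c%:P%:F.

Fact polyCF_zmod : zmod_morphism polyCF.
Proof. by move=> x y; rewrite /polyCF polyCB tofracB. Qed.

Fact polyCF_monoid : monoid_morphism polyCF.
Proof. by split=> [|x y]; rewrite /polyCF ?polyCM ?tofracM ?polyC1 ?tofrac1. Qed.

HB.instance Definition _ := GRing.isZmodMorphism.Build _ _ polyCF polyCF_zmod.
HB.instance Definition _ := GRing.isMonoidMorphism.Build _ _ polyCF polyCF_monoid.

Definition evalat (P : diffpoly F) : K := mmap polyCF evalmon P.

Lemma devalE P : deval P u = evalat P. Proof. by []. Qed.

Fact evalat_zmod : zmod_morphism evalat.
Proof. exact: mmap_is_additive. Qed.

Fact evalat_monoid : monoid_morphism evalat.
Proof.
by have [evalM eval1] := @mmap_is_multiplicative _ _ _ polyCF evalmon.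
Qed.

HB.instance Definition _ := GRing.isZmodMorphism.Build _ _ evalat evalat_zmod.
HB.instance Definition _ := GRing.isMonoidMorphism.Build _ _ evalat evalat_monoid.

Lemma evalatD P Q : evalat (P + Q) = evalat P + evalat Q.
Proof. exact: (rmorphD evalat). Qed.

Lemma evalatM P Q : evalat (P * Q) = evalat P * evalat Q.
Proof. exact: (rmorphM evalat). Qed.

Lemma evalat_addM P Q R S :
  evalat (P * Q + R * S) = evalat P * evalat Q + evalat R * evalat S.
Proof. exact: (rmorph_addM evalat). Qed.

Lemma evalatC c : evalat c%:MP = polyCF c.
Proof. exact: mmapC. Qed.

Lemma evalat_monX m : evalat (monX F m) = evalmon m.
Proof.
rewrite monXE /evalat mmapU /=.
by rewrite /polyCF polyC1 tofrac1 mul1r.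
Qed.

Lemma evalat_term c m : evalat (c%:MP * monX F m) = polyCF c * evalmon m.
Proof. by rewrite -malgU_monX /evalat mmapU. Qed.

Lemma dmonom1 : dmonom F (onecm _) = 0.
Proof.
by rewrite (dmonomE F (fsubset_refl _)) (@mdom1 nat) big_seq_fset0.
Qed.

Lemma dmonomU i : dmonom F (ucm i) = monX F (ucm i.+1).
Proof.
rewrite (dmonomE F (fsubset_refl _)) mdomU big_seq_fset1 cmUU mulr1n.
congr monX; apply/eqP/cmP=> j; rewrite !(mulcmE, divcmE, ucmE).
by rewrite subnn.
Qed.

Lemma cmonom_ind (T : {cmonom nat} -> Prop) : T (onecm _) ->
  (forall i m, T m -> T (mulcm (ucm i) m)) -> forall m, T m.
Proof.
move=> T1 TU m; have [n] := ubnP (mdeg m); elim: n m => // n IHn m le_mn.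
have [/eqP s0|[i i_m]] := fset_0Vmem (finsupp m).
  suff -> : m = onecm _ by [].
  apply/eqP/cmP=> i; rewrite onecmE; apply/eqP; rewrite cmE_eq0 (eqP s0).
  by rewrite in_fset0.
have mi : (0 < m i)%N by rewrite lt0n cmE_neq0.
have Em : m = mulcm (ucm i) (divcm m (ucm i)).
  apply/eqP/cmP=> j; rewrite mulcmE divcmE ucmE.
  by case: eqVneq => [<-|_]; rewrite ?subn0 // subnKC.
rewrite Em; apply: TU; apply: IHn.
have : mdeg m = (mdeg (ucm i) + mdeg (divcm m (ucm i)))%N.
  by rewrite {1}Em; exact: mdegM.
by rewrite mdegU; lia.
Qed.

Let derd : is_derivation d := ratderiv_derivation F.

Lemma ratderivC c : d (polyCF c) = 0.
Proof. by rewrite /polyCF ratderiv_poly derivC tofrac0. Qed.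

Lemma evalat_dmonom m : evalat (dmonom F m) = d (evalmon m).
Proof.
elim/cmonom_ind: m => [|i m IHm].
  by rewrite dmonom1 evalmon1 rmorph0 (der1 derd).
rewrite dmonomM; apply: (etrans (evalat_addM _ _ _ _)).
rewrite (evalmonM (ucm i)) (der_mul derd); congr (_ * _ + _ * _).
- by rewrite evalmonU dmonomU; exact: (etrans (evalat_monX _) (evalmonU _)).
- exact: evalat_monX.
- exact: evalat_monX.
exact: IHm.
Qed.

Lemma evalat_dtotal P : evalat (dtotal P) = d (evalat P).
Proof.
elim/malg_ind: P => [|P Q IHP IHQ|_ [c m]].
- by rewrite dtotal0 rmorph0 (der0 derd).
- exact: (intertwine_add IHP IHQ (dtotal_is_additive P Q) evalatD (der_add derd)).
have E1 := etrans (congr1 evalat (dtotalU c m)) (evalatM c%:MP (dmonom F m)).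
have E2 := congr2 *%R (evalatC c) (evalat_dmonom m).
apply: (etrans (etrans E1 E2)); apply/esym/(etrans (congr1 d (evalat_term c m))).
by rewrite (der_mul derd) ratderivC mul0r add0r.
Qed.

End Evaluation.

Lemma der_eq_sub (A : pzRingType) (D : A -> A) :
  is_derivation D -> forall x y, D x = D y -> D (x - y) = 0.
Proof. by case=> DD _ x y Dxy; apply: (addIr (D y)); rewrite -DD subrK add0r. Qed.

Lemma rmorph_eq_sub (A B : pzRingType) (f : {rmorphism A -> B}) x y :
  f x = f y -> f (x - y) = 0.
Proof. by move=> E; rewrite rmorphB E subrr. Qed.

(** * The kernel of the total derivative *)

Section TotalDerivativeKernel.
Variables (F : fieldType) (natr_neq0 : forall n, n.+1%:R != 0 :> F).

Lemma coef_dmonom m k : (dmonom F m)@_k =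
  \sum_(i <- finsupp m) (mulcm (divcm m (ucm i)) (ucm i.+1) == k)%:R *+ m i.
Proof.
rewrite (dmonomE F (fsubset_refl _)) raddf_sum; apply: eq_bigr => i _ /=.
by rewrite mcoeffMn monXE mcoeffU1.
Qed.

Lemma coef_dtotal (P : diffpoly F) k :
  (dtotal P)@_k = \sum_(m <- msupp P) P@_m * (dmonom F m)@_k.
Proof.
rewrite dtotalE mmapE raddf_sum; apply: eq_bigr => m _ /=.
exact: mcoeffCM.
Qed.

(** The exponents of [u_(n+1)] decide: it is positive on the right, while on the left [m1]
    contributes none, so the factor [u_(i+1)] must be [u_(n+1)]. *)
Lemma divcm_inj (m1 m2 : {cmonom nat}) i n :
    (0 < m1 i)%N -> (i <= n)%N -> (0 < m2 n)%N -> m1 n.+1 = 0%N ->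
    mulcm (divcm m1 (ucm i)) (ucm i.+1) = mulcm (divcm m2 (ucm n)) (ucm n.+1) ->
  i = n /\ m1 = m2.
Proof.
move=> m1i le_in m2n m1n /eqP/cmP E.
have := E n.+1; rewrite !(mulcmE, divcmE, ucmE) m1n eqxx sub0n add0n.
rewrite eqSS; have [Ein _|//] := eqVneq i n; last by rewrite addn1.
split=> //; rewrite {}Ein in m1i E *; apply/eqP/cmP=> j.
have := E j; rewrite !(mulcmE, divcmE, ucmE) => /addIn.
have [<-|_] := eqVneq n j; rewrite ?subn0 // !subn1 => /(congr1 S).
by rewrite !prednK.
Qed.

(* If [u_n] is the highest variable of [P] and occurs in the monomial [m], then [m * u_(n+1) / u_n] occurs in the total
   derivative, and comes from [m] alone. *)
Lemma dtotal_eq0 (P : diffpoly F) : dtotal P = 0 -> P = (P@_(onecm _))%:MP.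
Proof.
move=> dP0; pose occurs n := has (fun m : {cmonom nat} => m n != 0%N) (msupp P).
have [[n0 occ0]|no_occ] := pselect (exists n, occurs n); last first.
  apply/malgP => m; rewrite mcoeffC; case: eqP => [->//|ne_m1].
  rewrite mulr0n; apply/eqP; rewrite mcoeff_eq0; apply/negP=> m_P.
  apply: ne_m1; apply/eqP/cmP=> n; rewrite onecmE; apply/eqP/negPn/negP=> mn.
  by apply: no_occ; exists n; apply/hasP; exists m.
pose B := (\max_(m <- msupp P) \max_(i <- finsupp m) i)%N.
have leB n : occurs n -> (n <= B)%N.
  case/hasP=> m m_P mn; rewrite /B.
  rewrite (big_fsetD1 m) //= leq_max (big_fsetD1 n) /= ?leq_max ?leqnn //.
  by rewrite -cmE_neq0.
case: (ex_maxnP (ex_intro occurs n0 occ0) leB) => n /hasP[m m_P mn] max_n.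
have {max_n} max_n m' i : m' \in msupp P -> (n < i)%N -> m' i = 0%N.
  move=> m'_P lt_ni; apply/eqP/negPn/negP => m'i.
  by move: lt_ni; rewrite ltnNge max_n //; apply/hasP; exists m'.
rewrite -lt0n in mn; pose k := mulcm (divcm m (ucm n)) (ucm n.+1).
have other m' i : m' \in msupp P -> i \in finsupp m' ->
    mulcm (divcm m' (ucm i)) (ucm i.+1) = k -> i = n /\ m' = m.
  move=> m'_P i_m'; have m'i : (0 < m' i)%N by rewrite lt0n cmE_neq0.
  apply: divcm_inj => //; last exact: max_n.
  by rewrite leqNgt; apply/negP=> /(max_n _ _ m'_P) Z; rewrite Z in m'i.
have := congr1 (mcoeff k) dP0; rewrite mcoeff0 coef_dtotal.
rewrite (big_fsetD1 m) //= big_seq big1 ?addr0 => [|m']; last first.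
  rewrite !inE => /andP[ne_m' m'_P]; rewrite coef_dmonom big_seq big1 ?mulr0 //.
  move=> i i_m'; case: eqP => [/(other _ _ m'_P i_m')[_ Em]|]; last by rewrite mul0rn.
  by rewrite Em eqxx in ne_m'.
have n_m : n \in finsupp m by rewrite -cmE_neq0 -lt0n.
rewrite coef_dmonom (big_fsetD1 n) //= eqxx big_seq big1 ?addr0 => [|i].
  move/eqP; rewrite mulf_eq0 (negPf (_ : P@_m != 0)); last by rewrite mcoeff_neq0.
  by case: (m n) mn => // j _; rewrite (negPf (natr_neq0 _)).
rewrite !inE => /andP[ne_i i_m].
by case: eqP => [/(other _ _ m_P i_m)[Ei]|]; rewrite ?mul0rn // Ei eqxx in ne_i *.
Qed.

Lemma dtotal_malgC c : dtotal (c%:MP : diffpoly F) = 0.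
Proof.
have E : c%:MP = c%:MP * monX F (onecm _) by rewrite -malgU_monX.
apply: (etrans (congr1 _ E)); apply: (etrans (dtotalU c _)).
by apply: (etrans (congr1 _ (dmonom1 F))); apply: mulr0.
Qed.

(** The difference has zero total derivative, so it is a constant, and evaluation at [0] kills it.
    This is the uniqueness of the Lenard polynomials. *)
Lemma dtotal_deval0_inj (P Q : diffpoly F) : dtotal P = dtotal Q ->
  evalat 0 P = evalat 0 Q -> P = Q.
Proof.
move=> dPQ PQ0; apply/subr0_eq.
have E := dtotal_eq0 (der_eq_sub (dtotal_derivation F) dPQ).
have E0 := rmorph_eq_sub (f := evalat 0) PQ0.
have := etrans (esym (evalatC 0 _)) (etrans (congr1 (evalat 0) (esym E)) E0).
rewrite /polyCF => /eqP; rewrite tofrac_eq0 polyC_eq0 => /eqP c0.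
by apply: (etrans E); rewrite c0; apply: malgC0E.
Qed.
End TotalDerivativeKernel.

Lemma qform_const (A : comNzRingType) (D : A -> A) a :
  is_derivation D -> D a = 0 -> qform D 0 a%:P = (a ^+ 2)%:P.
Proof.
move=> derD Da; rewrite /qform dcoefC // Da polyC0 polyC_exp.
by rewrite (der0 (dcoef_derivation derD)); ring.
Qed.

(** * Existence of the Lenard polynomials through the quadratic form *)

Section QuadraticRecursionMorphism.
Variables (A B : comNzRingType) (D : A -> A) (d : B -> B) (f : {rmorphism A -> B}).
Hypotheses (derD : is_derivation D) (derd : is_derivation d).
Hypothesis fD : forall a, f (D a) = d (f a).

Lemma map_dcoef P : map_poly f (dcoef D P) = dcoef d (map_poly f P).
Proof.
by apply/polyP=> i; rewrite coef_map !coef_dcoef // coef_map /= fD.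
Qed.

Lemma map_qform u P : map_poly f (qform D u P) = qform d (f u) (map_poly f P).
Proof.
rewrite /qform -!map_dcoef -map_polyC /=.
rewrite !(rmorph_nat, rmorphB, rmorphM, rmorphXn, rmorphD) /= map_polyX.
by rewrite !expr2.
Qed.

Variables (u h : A) (L : nat -> A).
Hypotheses (u0 : f u = 0) (L0 : L 0 = h) (h2 : 2%:R * h = 1) (Dh : D h = 0).
Hypothesis L_unique : forall k c,
  D c = D (D (D (L k))) + 4%:R * u * D (L k) + 2%:R * D u * L k ->
  f c = 0 -> L k.+1 = c.

Lemma quadratic_recursion_aux n :
  (forall j, (j <= n)%N -> (qform D u (\poly_(i < n.+1) L i))`_j = (h ^+ 2)%:P`_j) /\
  (forall i, (0 < i <= n)%N -> f (L i) = 0).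
Proof.
elim: n => [|n [IHq IHf]].
  split=> [|i]; last by case: i.
  case=> // _; rewrite /qform coefB coefXM subr0 coefC eqxx.
  by rewrite expr2 coefM big_ord1 coef_poly /= L0 expr2.
set P := \poly_(i < n.+1) L i in IHq *.
have P0 : P`_0 = h by rewrite coef_poly /= L0.
(* Since [2h = 1], adding [c] at order [n+1] changes that coefficient of [qform] by exactly [c],
   which cancels it. *)
pose c := - (qform D u P)`_n.+1; pose R := P + c%:P * 'X^(n.+1).
have qR j : (j <= n.+1)%N -> (qform D u R)`_j = (h ^+ 2)%:P`_j.
  move=> le_j; rewrite /R coef_qform_addXn // P0 [c%:P`_0]coefC eqxx h2 mul1r.
  case: eqVneq => [->|ne_j]; first by rewrite mulr1n subrr coefC.
  by rewrite mulr0n addr0 IHq //; lia.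
have Rn : R`_n = L n by rewrite coefD coef_poly ltnSn coefMXn ltnSn addr0.
have Rn1 : R`_n.+1 = c.
  by rewrite coefD coef_poly ltnn coefMXn ltnn subnn coefC add0r.
have Dc : D c = D (D (D (L n))) + 4%:R * u * D (L n) + 2%:R * D u * L n.
  have R0 : 2%:R * R`_0 = 1 by rewrite coefD coefMXn /= addr0 P0.
  have DqR j : (j <= n.+1)%N -> D (qform D u R)`_j = 0.
    move/qR->; rewrite coefC; case: ifP => _; last exact: (der0 derD).
    by rewrite expr2 (der_mul derD) Dh mul0r mulr0 addr0.
  have /eqP := qform_lenard derD R0 DqR (leqnn _).
  rewrite /lenard_defect coefB coefXM /= !coefD -!polyC_natr -!polyCM !coefCM.
  by rewrite !coef_dcoef // Rn Rn1 subr_eq0 => /eqP.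
have fc : f c = 0.
  rewrite /c rmorphN /= -coef_map map_qform u0.
  (* Under [f] all coefficients of [P] except the first vanish by induction, so its quadratic form
     becomes a constant, without a term of order [n+1]. *)
  have -> : map_poly f P = (f h)%:P.
    apply/polyP=> i; rewrite coef_map coef_poly coefC.
    case: i => [|i]; rewrite /= ?L0 //; case: ifP => lt_i; last exact: rmorph0.
    by rewrite IHf.
  by rewrite (qform_const derd) ?coefC ?oppr0 // -fD Dh rmorph0.
have EL := L_unique Dc fc.
have ER : \poly_(i < n.+2) L i = R.
  apply/polyP=> i; rewrite coefD !coef_poly coefMXn coefC ltnS leq_eqVlt.
  case: eqVneq => [->|ne_i] /=; first by rewrite EL ltnn subnn add0r.
  case: ltnP => [lt_i|ge_i]; first by rewrite addr0.
  by rewrite subn_eq0 leqNgt ltn_neqAle eq_sym ne_i ge_i addr0.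
split=> [j|i /andP[i_gt0]]; first by rewrite ER; apply: qR.
by rewrite leq_eqVlt => /predU1P[->|lt_i]; rewrite ?EL // IHf ?i_gt0.
Qed.

Lemma quadratic_recursion n j : (j <= n)%N ->
  (qform D u (\poly_(i < n.+1) L i))`_j = (h ^+ 2)%:P`_j.
Proof. by case: (quadratic_recursion_aux n) => H _; apply: H. Qed.

End QuadraticRecursionMorphism.

Section QuadraticRecursionImage.
Variables (A B C : comNzRingType) (D : A -> A) (d : B -> B) (e : C -> C).
Variables (f : {rmorphism A -> B}) (g : {rmorphism A -> C}).
Hypotheses (derD : is_derivation D) (derd : is_derivation d) (dere : is_derivation e).
Hypotheses (fD : forall a, f (D a) = d (f a)) (gD : forall a, g (D a) = e (g a)).
Variables (u h : A) (L : nat -> A).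
Hypotheses (u0 : f u = 0) (L0 : L 0 = h) (h2 : 2%:R * h = 1) (Dh : D h = 0).
Hypothesis L_unique : forall k c,
  D c = D (D (D (L k))) + 4%:R * u * D (L k) + 2%:R * D u * L k ->
  f c = 0 -> L k.+1 = c.

Lemma quadratic_recursion_map n j : (j <= n)%N ->
  (qform e (g u) (\poly_(i < n.+1) g (L i)))`_j = (g h ^+ 2)%:P`_j.
Proof.
move=> le_jn.
have := quadratic_recursion derD derd fD u0 L0 h2 Dh L_unique le_jn.
move/(congr1 g); rewrite -2!coef_map (map_qform derD dere gD) map_polyC /= rmorphXn => <-.
congr (qform _ _ _)`_ _; apply/polyP=> i; rewrite coef_map !coef_poly.
by case: ifP => _ //; apply/esym/rmorph0.
Qed.

End QuadraticRecursionImage.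

Lemma natr_scale_eq (R : pzRingType) (A : lalgType R) (x y v w z : A) :
  z + 4%:R * v * y + 2%:R * w * x = z + 4%:R *: (v * y) + 2%:R *: (w * x).
Proof. by rewrite !scaler_nat -!mulrA !mulr_natl. Qed.

(** * The Lenard polynomials satisfy the quadratic identity *)

Section Lenard.
Variables (F : fieldType) (natr_neq0 : forall n, n.+1%:R != 0 :> F).
Notation K := {fraction {poly F}}.

Lemma dtotal_dvar i : dtotal (dvar F i) = dvar F i.+1.
Proof.
have E j : dvar F j = 1%:MP * monX F (ucm j) by rewrite -malgU_monX.
apply: (etrans (congr1 _ (E i))); apply: (etrans (dtotalU 1 (ucm i))).
apply: (etrans (congr1 _ (dmonomU F i))); exact: (esym (E i.+1)).
Qed.

(** A solution [c] shows that [xget] does not fall back on its default [0], and uniqueness then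
    forces the chosen solution to be [c]. *)
Lemma lenard_unique k c : dtotal c = dtotal (dtotal (dtotal (lenard F k)))
    + 4%:R * dvar F 0 * dtotal (lenard F k)
    + 2%:R * dtotal (dvar F 0) * lenard F k ->
  evalat 0 c = 0 -> lenard F k.+1 = c.
Proof.
move=> Dc c0.
have Sc : dtotal c = dtotal (dtotal (dtotal (lenard F k)))
                 + 4%:R *: (dvar F 0 * dtotal (lenard F k))
                 + 2%:R *: (dvar F 1 * lenard F k) /\ deval c 0 = 0.
  split; last exact: c0.
  apply: (etrans Dc); rewrite dtotal_dvar; exact: natr_scale_eq.
apply: (@xget_unique _ 0 _ c Sc) => y [Dy y0].
apply: (dtotal_deval0_inj natr_neq0); first exact: (etrans Dy (esym Sc.1)).
exact: (etrans y0 (esym c0)).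
Qed.

Lemma lenard_half : 2%:R * (2%:R^-1 : F)%:MP = 1 :> diffpoly F.
Proof.
have E : 2%:R = (2%:R : F)%:MP :> diffpoly F by rewrite rmorph_nat.
apply: (etrans (congr1 (fun z => z * _) E)); apply: (etrans (esym (malgCM _ _))).
exact: (congr1 (@malgC _ F) (divff (natr_neq0 1))).
Qed.

Lemma lenard_quadratic (u : K) n j : (j <= n)%N ->
  (qform (@ratderiv F) u (\poly_(i < n.+1) deval (lenard F i) u))`_j =
  (2%:R^-1 ^+ 2)%:P`_j.
Proof.
move=> le_jn.
have ev0 : evalat 0 (dvar F 0) = 0.
  by apply: (etrans (congr1 _ (esym (monXE F _)))); rewrite evalat_monX evalmonU.
have evu : evalat u (dvar F 0) = u.
  by apply: (etrans (congr1 _ (esym (monXE F _)))); rewrite evalat_monX evalmonU.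
have ev_half : evalat u (lenard F 0) = 2%:R^-1.
  by apply: (etrans (evalatC u _)); rewrite fmorphV rmorph_nat.
have H v c : evalat u (dvar F 0) = v -> evalat u (lenard F 0) = c ->
    (qform (@ratderiv F) v (\poly_(i < n.+1) deval (lenard F i) u))`_j = (c ^+ 2)%:P`_j.
  move=> <- <-.
  exact: (quadratic_recursion_map (dtotal_derivation F) (ratderiv_derivation F)
    (ratderiv_derivation F) (evalat_dtotal 0) (evalat_dtotal u) ev0
    (erefl (lenard F 0)) lenard_half (dtotal_malgC _) lenard_unique le_jn).
exact: H evu ev_half.
Qed.
End Lenard.

(** * Truncated exponentials *)

Section TruncatedExponential.
Variables (K : fieldType) (natr_neq0 : forall n, n.+1%:R != 0 :> K).
Implicit Types theta : {poly K}.

Definition trunc_exp M theta := \sum_(m < M) (m`!%:R)^-1 *: theta ^+ m.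

Lemma fact_neq0 m : m`!%:R != 0 :> K.
Proof. by rewrite -(prednK (fact_gt0 m)). Qed.

Lemma trunc_expS M theta :
  trunc_exp M.+1 theta = trunc_exp M theta + (M`!%:R)^-1 *: theta ^+ M.
Proof. exact: big_ord_recr. Qed.

Lemma dvdXn_exp theta m : theta`_0 = 0 -> 'X^m %| theta ^+ m.
Proof.
move=> theta0; apply: dvdp_exp2r; rewrite -['X]expr1; apply/dvdXnP.
by case.
Qed.

Lemma coef_trunc_exp M theta k : theta`_0 = 0 -> (k < M)%N ->
  (trunc_exp M theta)`_k = expcoef theta k.
Proof.
move=> theta0; elim: M => // M IHM; rewrite ltnS leq_eqVlt.
case/predU1P => [->//|lt_kM]; rewrite trunc_expS coefD IHM // coefZ.
by rewrite (dvdXnP _ _ (dvdXn_exp M theta0)) // mulr0 addr0.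
Qed.

Lemma trunc_exp0 M theta : theta`_0 = 0 -> (trunc_exp M.+1 theta)`_0 = 1.
Proof.
move=> theta0; rewrite coef_trunc_exp // /expcoef big_ord1 expr0 fact0.
by rewrite invr1 scale1r coef1.
Qed.

Lemma trunc_exp1 M theta : theta`_0 = 0 -> (trunc_exp M.+2 theta)`_1 = theta`_1.
Proof.
move=> theta0; rewrite coef_trunc_exp // /expcoef !big_ord_recr big_ord0 /= add0r.
by rewrite expr0 expr1 fact0 factS fact0 mul1n coefD !coefZ coef1 mulr0 add0r invr1 mul1r.
Qed.

(** Stated for any derivation linear over the inverse factorials, so as to cover both the derivative
    in [w] and the one in [x]. *)
Lemma der_trunc_exp (D : {poly K} -> {poly K}) M theta : is_derivation D ->
    (forall m p, D ((m`!%:R)^-1 *: p) = (m`!%:R)^-1 *: D p) ->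
  D (trunc_exp M.+1 theta) = D theta * trunc_exp M theta.
Proof.
move=> derD Dlin; elim: M => [|M IHM].
  rewrite /trunc_exp big_ord1 big_ord0 mulr0 Dlin expr0.
  by rewrite (der1 derD) scaler0.
rewrite trunc_expS (der_add derD) IHM [in RHS]trunc_expS mulrDr; congr (_ + _).
rewrite Dlin (der_exp derD) /= -scalerAr factS natrM -scaler_nat scalerA.
by congr (_ *: _); rewrite invfM mulrAC mulVf ?mul1r.
Qed.

Lemma deriv_derivation : is_derivation (@deriv K).
Proof. by split=> p q; rewrite ?derivD ?derivM. Qed.

Lemma deriv_trunc_exp M theta : theta`_0 = 0 -> let E := trunc_exp M.+1 theta in
  'X^M %| E^`() - theta^`() * E.
Proof.
move=> theta0 /=; rewrite (der_trunc_exp _ _ deriv_derivation) => [|m p].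
  rewrite trunc_expS -mulrBr opprD addrA subrr sub0r.
  by rewrite dvdp_mull // dvdpNr -mul_polyC dvdp_mull // dvdXn_exp.
by rewrite derivZ.
Qed.

Lemma dcoef_trunc_exp (d : K -> K) M theta : is_derivation d -> theta`_0 = 0 ->
    dcoef d theta = 'X -> let E := trunc_exp M.+1 theta in
  'X^(M.+1) %| dcoef d E - 'X * E.
Proof.
move=> der_d theta0 dtheta /=.
have derD := dcoef_derivation der_d.
rewrite (der_trunc_exp _ _ derD) => [|m p].
  rewrite dtheta trunc_expS -mulrBr opprD addrA subrr sub0r exprS.
  by rewrite dvdp_mul // dvdpNr -mul_polyC dvdp_mull // dvdXn_exp.
rewrite -!mul_polyC (der_mul derD) dcoefC // -[X in X%:P * p](_ : 0 = _) ?mul0r ?add0r //.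
rewrite (der_inv der_d (fact_neq0 m)) (der_nat der_d).
by rewrite oppr0 mul0r.
Qed.

(** Truncation spoils the addition law of the exponential. Instead, [E(w) E(-w) - 1] vanishes at
    [w = 0] and its derivative vanishes modulo ['X^M], because [theta'] is even. *)
Lemma trunc_exp_flip M theta : flip theta = - theta ->
  let E := trunc_exp M.+1 theta in 'X^(M.+1) %| E * flip E - 1.
Proof.
move=> odd_theta /=; set E := trunc_exp _ _.
have theta0 : theta`_0 = 0.
  have /(congr1 (fun p : {poly K} => p`_0)) := odd_theta.
  rewrite coef_flip expr0 mul1r coefN => /eqP; rewrite -addr_eq0 -mulr2n -mulr_natl.
  by rewrite mulf_eq0 (negPf (natr_neq0 1)) => /eqP.
have dE : 'X^M %| E^`() - theta^`() * E by apply: deriv_trunc_exp.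
have flip_d : flip theta^`() = theta^`().
  by have := deriv_flip theta; rewrite odd_theta derivN => /oppr_inj.
pose G := E * flip E - 1.
have dG : 'X^M %| G^`().
  have -> : G^`() = (E^`() - theta^`() * E) * flip E
                    - E * flip (E^`() - theta^`() * E).
    rewrite /G derivB derivM deriv_flip -[1]/1%:P derivC rmorphB rmorphM /= flip_d.
    by ring.
  by apply: dvdp_sub; [exact: dvdp_mulr | rewrite dvdp_mull // dvdXn_flip].
apply/dvdXnP => -[_|i lt_i].
  by rewrite coefB coefM big_ord1 coef_flip trunc_exp0 // expr0 !mul1r coef1 subrr.
have /eqP := dvdXnP _ _ dG i lt_i; rewrite coef_deriv -mulr_natl mulf_eq0.
by rewrite (negPf (natr_neq0 i)) => /eqP.
Qed.

End TruncatedExponential.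

(** * Tau functions *)

Section TauFunctions.
Variables (K : fieldType) (natr_neq0 : forall n, n.+1%:R != 0 :> K).
Variables (M : nat) (E V : {poly K}) (d : K -> K) (der_d : is_derivation d).
Hypotheses (E0 : E`_0 = 1) (E1 : E`_1 != 0) (EF : 'X^M %| E * flip E - 1).
Hypotheses (Ed : 'X^M %| dcoef d E - 'X * E) (EV : 'X^(M.-1) %| E^`() - V * E).
Variables (tau Phi : nat -> K).
Hypotheses (tau0 : tau 0 = 1) (tau1 : tau 1 = E`_1).
Hypothesis tauSS : forall k, tau k.+2 = tau k.+1 ^+ 2 * Phi k.+1 / tau k.
Hypothesis PhiE : forall k, (2 * k.+1 < M)%N ->
  pade_u E d k = 2%:R * d (dlog d (tau k)) ->
  Phi k = (-1) ^+ k * (V * pade_sq E k)`_(2 * k).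

Definition kappa k : K := (-1) ^+ k * ((2 * k)`!%:R / k`!%:R).

Lemma kappaS k : kappa k.+1 = - (2 * (2 * k).+1)%:R * kappa k.
Proof.
rewrite /kappa mulnS !factS exprS !natrM.
have k0 := fact_neq0 natr_neq0 k; have k1 := natr_neq0 k.
rewrite (_ : (2 * k).+2 = 2 * k.+1)%N ?natrM; last by lia.
by field; rewrite k0 nat1r k1.
Qed.

Lemma kappa_neq0 k : kappa k != 0.
Proof.
by rewrite mulf_eq0 signr_eq0 mulf_eq0 invr_eq0 !(negPf (fact_neq0 natr_neq0 _)).
Qed.

Lemma der_kappa k : d (kappa k) = 0.
Proof.
rewrite /kappa !(der_mul der_d) (der_sign der_d) (der_inv der_d) ?fact_neq0 //.
by rewrite !(der_nat der_d) oppr0 !mul0r mulr0 addr0 mulr0 addr0.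
Qed.

(** The claims support each other: the formula for [u_k] makes [PhiE] applicable, [pade_contour]
    then evaluates [Phi] by [eps] and [b], and the recurrence yields the next [tau], nonzero and
    with the right constant. The next potential comes from the logarithmic derivative of the third
    claim. *)
Lemma tau_pade_const k : (2 * k.+1 < M)%N ->
  [/\ tau k != 0, tau k.+1 != 0,
      pade_const E k.+1 * tau k.+1 = kappa k.+1 * tau k &
      pade_u E d k = 2%:R * d (dlog d (tau k))].
Proof.
have nondeg := pade_nondeg natr_neq0 E0 E1 EF der_d Ed.
have constP := eps_pade_const E1 EF.
elim: k => [|k IHk] lt_kM.
  rewrite tau0 tau1 oner_neq0 E1 (pade_u0 natr_neq0 E0 E1 EF der_d Ed) //.
  split=> //; last by rewrite /dlog (der1 der_d) mul0r (der0 der_d) mulr0.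
  have := constP 0 (nondeg _ lt_kM); rewrite eps0 mulrC => ->.
  by rewrite mulr1 /kappa (_ : (2 * 1)`! = 2)%N // (_ : 1`! = 1)%N // divr1.
have [|tk0 tk1 bt uk] := IHk; first by lia.
have lt_kM' : (2 * k.+1 < M)%N by lia.
have b0 := pade_const_neq0 natr_neq0 E1 EF (nondeg _ lt_kM').
have uk1 : pade_u E d k.+1 = 2%:R * d (dlog d (tau k.+1)).
  rewrite (pade_u_succ natr_neq0 E0 E1 EF der_d Ed) // uk /pade_s -/(dlog d _).
  have Eb : dlog d (pade_const E k.+1) = dlog d (tau k) - dlog d (tau k.+1).
    have := congr1 (dlog d) bt; rewrite (dlogM der_d b0 tk1) (dlogM der_d (kappa_neq0 _) tk0).
    rewrite [dlog d (kappa _)]/dlog der_kappa mul0r add0r => <-; ring.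
  by rewrite Eb (der_opp der_d) (der_sub der_d); ring.
have Phi1 : Phi k.+1 = (-1) ^+ k.+1 * ((2 * k.+1).+1%:R * eps E k.+1 * pade_const E k.+1).
  by rewrite PhiE // (pade_contour natr_neq0 E0 E1 EF der_d Ed).
have eps1 := constP k.+1 (nondeg _ lt_kM).
have e0 : eps E k.+1 != 0 by apply: (nondeg _ lt_kM).
have tk2 : tau k.+2 != 0.
  rewrite tauSS Phi1 mulf_neq0 ?invr_neq0 // mulf_neq0 ?expf_neq0 //.
  by rewrite mulf_neq0 ?signr_eq0 // !mulf_neq0.
split=> //; rewrite tauSS Phi1 kappaS.
have sgn : (-1) ^+ k.+2 * (-1) ^+ k.+1 = -1 :> K.
  by rewrite exprS -mulrA -expr2 sqrr_sign mulr1.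
(* Regrouped so that the two known products [eps_(k+1) b_(k+2)] and [b_(k+1) tau_(k+1)] appear. *)
transitivity (eps E k.+1 * pade_const E k.+2 * (-1) ^+ k.+1 * (2 * k.+1).+1%:R
  * tau k.+1 * (pade_const E k.+1 * tau k.+1) / tau k); first by ring.
rewrite eps1 bt [_ ^+ k.+2 * _ * _]mulrAC sgn natrM; move: (_.+1%:R) (kappa _) => a b.
by field.
Qed.

(** With [b = b_(k+1)], the squares of consecutive [tau] have ratio [kappa_(k+1)^2 / b^2], and
    consecutive Hankel determinants have ratio [eps_k / b = 2 (-1)^(k+1) / b^2]. The factor [b]
    drops out, and the constants accumulate to the stated product. *)
Lemma tau_sqr_hankel k : (2 * k.+1 < M)%N -> tau k ^+ 2 =
  (-1) ^+ 'C(k.+1, 2) * (2%:R ^+ k)^-1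
  * (\prod_(1 <= j < k.+1) ((2 * j)`!%:R / j`!%:R) ^+ 2) * \det (hankel E k.+1).
Proof.
elim: k => [|k IHk] lt_kM.
  rewrite tau0 expr1n big_geq // bin_small // !expr0 invr1 !mul1r.
  by rewrite det_mx11 mxE E0.
have lt_kM' : (2 * k.+1 < M)%N by lia.
have nd := pade_nondeg natr_neq0 E0 E1 EF der_d Ed lt_kM'.
have b0 := pade_const_neq0 natr_neq0 E1 EF nd.
have [tk0 tk1 bt _] := tau_pade_const lt_kM'.
have [r sz_r [r0 rE rEtop]] := pade_hankel_vector natr_neq0 E0 E1 EF der_d Ed lt_kM'.
rewrite (det_hankelS sz_r r0 rE) rEtop.
have epsE : eps E k = (-1) ^+ k.+1 * 2%:R / pade_const E k.+1.
  by rewrite -(eps_pade_const E1 EF nd) mulfK.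
have tE : tau k.+1 = kappa k.+1 * tau k / pade_const E k.+1.
  by rewrite -bt mulrC mulKf.
rewrite tE expr_div_n exprMn IHk // epsE.
rewrite [\prod_(1 <= j < k.+2) _]big_nat_recr //= (binS k.+1 1) bin1 exprD.
rewrite [kappa _ ^+ 2]exprMn sqrr_sign mul1r [2%:R ^+ k.+1]exprS.
have sgn2 : (-1) ^+ k.+1 * (-1) ^+ k.+1 = 1 :> K by rewrite -expr2 sqrr_sign.
have two0 : 2%:R != 0 :> K := natr_neq0 1.
have twok0 : 2%:R ^+ k != 0 :> K by rewrite expf_neq0.
move: sgn2 twok0 b0; move: ((-1) ^+ k.+1) ((-1) ^+ 'C(_, _)) (2%:R ^+ k) => s sc tw.
move: (pade_const _ _) (\det _) => b H; set P := \prod_(1 <= j < k.+1) _.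
move: P ((2 * k.+1)`!%:R / _) => P kap.
move=> sgn2 tw0 b0; rewrite -[LHS]mul1r -{1}sgn2; field.
by rewrite b0 tw0 two0.
Qed.

End TauFunctions.

(** * The odd time polynomial *)

Section TimePolynomial.

(** Over an arbitrary ring, so that one formula serves for a number [x], for polynomials in [x] and
    for rational functions in [x]. *)
Definition odd_times (A : comNzRingType) N (x : A) (s : 'I_N.-1 -> A) (c : A) : {poly A} :=
  x *: 'X + \sum_(k < N.-1) s k *: 'X^(2 * k + 3) - c *: 'X^(2 * N + 1).

Lemma map_odd_times (A B : comNzRingType) (f : {rmorphism A -> B}) N x (s : 'I_N.-1 -> A) c :
  map_poly f (odd_times x s c) = odd_times (f x) (fun k => f (s k)) (f c).
Proof.
rewrite /odd_times rmorphB rmorphD /= rmorph_sum /= !map_polyZ map_polyX map_polyXn.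
by congr (_ + _ - _); apply: eq_bigr => k _; rewrite map_polyZ map_polyXn.
Qed.

Lemma time_polyE (F : fieldType) N (t : 'rV[F]_N.-1) x :
  time_poly t x = odd_times x (t 0) (2 * N + 1)%:R^-1.
Proof. by []. Qed.

Variables (K : fieldType) (N : nat) (x : K) (s : 'I_N.-1 -> K) (c : K).
Let theta := odd_times x s c.

Lemma flip_odd_times : flip theta = - theta.
Proof.
have flipXn i j : odd j -> flip (i *: 'X^j) = - (i *: 'X^j) :> {poly K}.
  by move=> odd_j; rewrite flipZ rmorphXn /= flipX exprNn -signr_odd odd_j expr1 mulN1r scalerN.
rewrite /theta /odd_times rmorphB rmorphD rmorph_sum /= -['X]expr1 !flipXn //; last first.
  by rewrite oddD oddM.
rewrite (eq_bigr (fun k : 'I_N.-1 => - (s k *: 'X^(2 * k + 3)))) ?sumrN => [|k _].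
  by rewrite !opprD.
by rewrite flipXn // oddD oddM.
Qed.

Lemma odd_times0 : theta`_0 = 0.
Proof.
rewrite coefB coefD !coefZ coefX coefXn addn1 !mulr0 subr0 add0r coef_sum big1 // => k _.
by rewrite coefZ coefXn addnC mulr0.
Qed.

Lemma odd_times1 : (1 <= N)%N -> theta`_1 = x.
Proof.
move=> N1; rewrite coefB coefD !coefZ coefX coefXn mulr1 coef_sum big1 => [|k _].
  by rewrite (_ : (1 == 2 * N + 1)%N = false) ?mulr0 ?subr0 ?addr0 //; lia.
by rewrite coefZ coefXn addnC mulr0.
Qed.

Lemma dcoef_odd_times (d : K -> K) : is_derivation d -> d x = 1 ->
  (forall k, d (s k) = 0) -> d c = 0 -> dcoef d theta = 'X.
Proof.
move=> der_d dx ds dc; have derD := dcoef_derivation der_d.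
have dZ a n : dcoef d (a *: 'X^n) = d a *: 'X^n.
  by rewrite -mul_polyC dcoef_mulXn // dcoefC // mul_polyC.
rewrite /theta /odd_times (der_sub derD) (der_add derD) (der_sum derD).
rewrite -{1}['X]expr1 !dZ dx dc scale1r scale0r subr0 big1 ?addr0 // => k _.
by rewrite dZ ds scale0r.
Qed.

Lemma coef_pade_gen_shift (E : {poly K}) k i :
  (-1) ^+ k * ('X^(2 * i) * pade_sq E k)`_(2 * k) = (pade_gen E k)`_i.
Proof.
by rewrite coefXnM coef_poly ltn_pmul2l // ltnS; case: leqP; rewrite ?mulr0.
Qed.

(** The derivative of [theta] has only even powers of [w], and [w^(2i)] extracts exactly the
    coefficient of index [i] of [pade_gen]. *)
Lemma odd_times_contour (E : {poly K}) k : let T := pade_gen E k in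
  (-1) ^+ k * (theta^`() * pade_sq E k)`_(2 * k) =
  x * T`_0 + \sum_(i < N.-1) (2 * i + 3)%:R * s i * T`_i.+1 - (2 * N + 1)%:R * c * T`_N.
Proof.
move=> T; have dXn a n : (a *: 'X^n)^`() = (n%:R * a) *: 'X^(n.-1) :> {poly K}.
  by rewrite derivZ derivXn -scaler_nat scalerA mulrC.
have term a i : (-1) ^+ k * (a *: 'X^(2 * i) * pade_sq E k)`_(2 * k) = a * T`_i.
  by rewrite -scalerAl coefZ mulrCA coef_pade_gen_shift.
rewrite /theta /odd_times derivB derivD (der_sum (deriv_derivation K)) derivZ derivX alg_polyC -[x%:P]mulr1.
rewrite mul_polyC -(expr0 'X) dXn addn1 /= mulrBl mulrDl coefB coefD mulrBr mulrDr.
rewrite -(muln0 2) !term mulr_suml coef_sum mulr_sumr; congr (_ + _ - _).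
apply: eq_bigr => i _; rewrite dXn (_ : (2 * i + 3).-1 = 2 * i.+1)%N ?term //; lia.
Qed.

End TimePolynomial.

(** * From the Pade approximants to the Vorob'ev-Yablonski polynomials *)

Lemma qform_scale (A : comNzRingType) (D : A -> A) u h (L : {poly A}) :
    is_derivation D -> D h = 0 ->
    L ^+ 2 = 1 + 'X * (2%:R * L * dcoef D (dcoef D L) - dcoef D L ^+ 2
                       + 4%:R * u%:P * L ^+ 2) ->
  qform D u (h%:P * L) = (h ^+ 2)%:P.
Proof.
move=> derD Dh EL; have dX := dcoef_derivation derD.
have dh p : dcoef D (h%:P * p) = h%:P * dcoef D p.
  by rewrite (der_mul dX) dcoefC // Dh mul0r add0r.
rewrite /qform !dh polyC_exp.
transitivity (h%:P ^+ 2 * (L ^+ 2 - 'X * (2%:R * L * dcoef D (dcoef D L)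
  - dcoef D L ^+ 2 + 4%:R * u%:P * L ^+ 2))); first by ring.
by rewrite {1}EL addrK mulr1.
Qed.

Definition hankel_const (L : fieldType) n : L := (-1) ^+ 'C(n.+1, 2) * (2%:R ^+ n)^-1
  * (\prod_(1 <= k < n.+1) ((2 * k)`!%:R / k`!%:R) ^+ 2).

Lemma fmorph_hankel_const (L L' : fieldType) (f : {rmorphism L -> L'}) n :
  f (hankel_const L n) = hankel_const L' n.
Proof.
rewrite /hankel_const !rmorphM /= fmorphV !rmorphXn /= rmorphN1 rmorph_nat rmorph_prod.
congr (_ * _); apply: eq_bigr => k _.
by rewrite rmorphXn /= rmorphM /= fmorphV !rmorph_nat.
Qed.

Section Assembly.
Variables (F : fieldType) (natr_neq0 : forall n, n.+1%:R != 0 :> F).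
Notation K := {fraction {poly F}}.

Lemma natr_neq0_frac n : n.+1%:R != 0 :> K.
Proof.
have -> : n.+1%:R = polyCF n.+1%:R :> K by rewrite rmorph_nat.
by rewrite /polyCF tofrac_eq0 polyC_eq0.
Qed.

(** Half of [pade_gen] and the generating function of the Lenard polynomials at [u_k] share the
    constant term [1/2] and the quadratic form [1/4], so [qform_inj] equates them. For [i > k] this
    says that the Lenard polynomial vanishes at [u_k]. *)
Lemma pade_gen_lenard M (E : {poly K}) k :
    E`_0 = 1 -> E`_1 != 0 -> 'X^M %| E * flip E - 1 ->
    'X^M %| dcoef (@ratderiv F) E - 'X * E -> (2 * k.+1 < M)%N -> forall i,
  (pade_gen E k)`_i = 2%:R * deval (lenard F i) (pade_u E (@ratderiv F) k).
Proof.
move=> E0 E1 EF Ed lt_kM i; set u := pade_u _ _ _; set d := @ratderiv F.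
have derd : is_derivation d := ratderiv_derivation F.
have two0 : 2%:R != 0 :> K := natr_neq0_frac 1.
pose L := (2%:R^-1)%:P * pade_gen E k.
pose P := \poly_(j < i.+1) deval (lenard F j) u.
have quad := pade_gen_quadratic natr_neq0_frac E0 E1 EF derd Ed lt_kM.
have qL : qform d u L = (2%:R^-1 ^+ 2)%:P.
  have half0 : d 2%:R^-1 = 0.
    by rewrite (der_inv derd two0) (der_nat derd) oppr0 mul0r.
  exact: qform_scale.
have L0 : L`_0 = 2%:R^-1 by rewrite coefCM pade_gen0 mulr1.
have P0 : P`_0 = 2%:R^-1.
  rewrite coef_poly /= devalE; apply: (etrans (evalatC u _)).
  by rewrite fmorphV rmorph_nat.
have PL : P`_i = L`_i.
  apply: (qform_inj derd (u := u) (n := i)) => // [||j le_ji].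
  - by rewrite P0 divff.
  - by rewrite P0 L0.
  by rewrite qL (lenard_quadratic natr_neq0 u le_ji).
have := PL; rewrite coef_poly ltnSn coefCM => ->.
by rewrite mulrA divff ?mul1r.
Qed.

Variables (N : nat) (N_gt0 : (1 <= N)%N) (t : 'rV[F]_N.-1).

Definition theta_poly : {poly {poly F}} :=
  odd_times 'X (fun k => (t 0 k)%:P) ((2 * N + 1)%:R^-1)%:P.

Definition theta_frac : {poly K} :=
  odd_times 'X%:F (fun k => polyCF (t 0 k)) (polyCF (2 * N + 1)%:R^-1).

(** The moments as polynomials in [x]: they embed in the rational functions, where the identity is
    proved, and can be evaluated at each point, where it is stated. *)
Definition mu_poly k : {poly F} :=
  (\sum_(m < k.+1) ((m`!%:R)^-1)%:P *: theta_poly ^+ m)`_k.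

Lemma morph_mu_poly (L : fieldType) (f : {rmorphism {poly F} -> L}) k :
  f (mu_poly k) = expcoef (map_poly f theta_poly) k.
Proof.
rewrite /mu_poly -coef_map rmorph_sum /=; congr ((polyseq _)`_k).
apply: eq_bigr => m _; rewrite map_polyZ rmorphXn /=; congr (_ *: _).
by rewrite -[f _]/((f \o polyC) _) fmorphV rmorph_nat.
Qed.

Lemma mu_polyE x k : (mu_poly k).[x] = mu t x k.
Proof.
rewrite -[LHS]/(horner_eval x (mu_poly k)) morph_mu_poly map_odd_times.
rewrite /mu time_polyE; congr (expcoef _ _).
rewrite /odd_times /= /horner_eval hornerX hornerC; congr (_ + _ - _).
by apply: eq_bigr => i _; rewrite hornerC.
Qed.

Lemma mu_poly_frac k : (mu_poly k)%:F = expcoef theta_frac k.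
Proof.
by have := morph_mu_poly (@FracField.tofrac {poly F}) k; rewrite map_odd_times.
Qed.

Lemma gvy_factorE M (E : {poly K}) k q :
    E`_0 = 1 -> E`_1 != 0 -> 'X^M %| E * flip E - 1 ->
    'X^M %| dcoef (@ratderiv F) E - 'X * E -> (2 * k.+1 < M)%N ->
    pade_u E (@ratderiv F) k = 2%:R * d2ln q ->
  gvy_factor t q = (-1) ^+ k * (theta_frac^`() * pade_sq E k)`_(2 * k).
Proof.
move=> E0 E1 EF Ed lt_kM Eu; rewrite odd_times_contour pade_gen0 mulr1.
have T := pade_gen_lenard E0 E1 EF Ed lt_kM; rewrite Eu in T.
rewrite T /gvy_factor.
have -> : (2 * N + 1)%:R * polyCF (2 * N + 1)%:R^-1 = 1 :> K.
  have nz : (2 * N + 1)%:R != 0 :> K by rewrite addn1; exact: natr_neq0_frac.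
  by rewrite fmorphV rmorph_nat; exact: (divff nz).
rewrite mul1r addrAC; congr (_ + _ - _); rewrite mulr_sumr.
apply: eq_bigr => i _; rewrite T mulrCA; congr (_ * _).
by rewrite -[_%:P%:F]/(polyCF _) rmorphM rmorph_nat.
Qed.

Lemma gvy_sqr n : exists2 Q : {poly F}, Q%:F = gvy t n &
  Q ^+ 2 = (hankel_const F n)%:P * \det (\matrix_(l < n.+1, j < n.+1) mu_poly (l + j)).
Proof.
(* The chain up to index [n] requires [2(n+1) < M], and the determinant uses moments of index at
   most [2n]. *)
pose M := (2 * n.+2)%N; pose E := trunc_exp M theta_frac.
have theta0 : theta_frac`_0 = 0 := odd_times0 _ _ _.
have derd := ratderiv_derivation F.
have E0 : E`_0 = 1 by apply: trunc_exp0.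
have E1x : E`_1 = 'X%:F.
  by rewrite /E trunc_exp1 // odd_times1.
have E1 : E`_1 != 0 by rewrite E1x tofrac_eq0 polyX_eq0.
have EF : 'X^M %| E * flip E - 1.
  exact: (trunc_exp_flip natr_neq0_frac _ (flip_odd_times _ _ _)).
have dtheta : dcoef (@ratderiv F) theta_frac = 'X.
  apply: dcoef_odd_times => //; last by rewrite ratderivC.
    by rewrite ratderiv_poly derivX tofrac1.
  by move=> k; rewrite ratderivC.
have Ed : 'X^M %| dcoef (@ratderiv F) E - 'X * E.
  exact: (dcoef_trunc_exp natr_neq0_frac).
have EV : 'X^(M.-1) %| E^`() - theta_frac^`() * E.
  exact: (deriv_trunc_exp natr_neq0_frac).
have lt_nM : (2 * n.+1 < M)%N by rewrite /M; lia.
have H := tau_sqr_hankel natr_neq0_frac derd E0 E1 EF Ed EV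
  (tau := gvy t) (Phi := fun k => gvy_factor t (gvy t k)) (erefl _) (esym E1x)
  (fun k => erefl _) (fun k lt_k => gvy_factorE E0 E1 EF Ed lt_k) lt_nM.
have detE : \det (hankel E n.+1) =
    (\det (\matrix_(l < n.+1, j < n.+1) mu_poly (l + j)))%:F.
  rewrite -[RHS](det_map_mx (@FracField.tofrac {poly F})); congr (\det _).
  apply/matrixP=> l j; rewrite !mxE coef_trunc_exp //; first exact/esym/mu_poly_frac.
  by have [lt_l lt_j] := (ltn_ord l, ltn_ord j); rewrite /M; lia.
rewrite detE -[X in _ = X * _]/(hankel_const K n) in H.
rewrite -(fmorph_hankel_const (polyCF (F := F))) in H.
have {}H : gvy t n ^+ 2 = (_%:P * _)%:F := etrans H (esym (tofracM _ _)).
have [Q EQ] := frac_sqr_poly H; exists Q => //.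
by apply: tofrac_inj; rewrite tofracXn EQ H.
Qed.
End Assembly.

Theorem theorem1p3 (R : realType) (N n : nat) (hN : (1 <= N)%N)
    (hn : (1 <= n)%N) (t : 'rV[R[i]]_N.-1) :
  exists2 Q : {poly R[i]}, Q%:F = gvy t n &
    forall x : R[i],
      Q.[x] ^+ 2 =
        (-1) ^+ 'C(n.+1, 2) * (2%:R ^+ n)^-1
        * (\prod_(1 <= k < n.+1) (((2 * k)`!)%:R / (k`!)%:R) ^+ 2)
        * \det (\matrix_(l < n.+1, j < n.+1) mu t x (l + j)).
Proof.
have natr_neq0 m : m.+1%:R != 0 :> R[i] by rewrite Num.Theory.pnatr_eq0.
have [Q EQ HQ] := gvy_sqr natr_neq0 hN t n; exists Q => // x.
rewrite -horner_exp HQ hornerM hornerC; congr (_ * _).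
rewrite -[LHS]/(horner_eval x _) -det_map_mx; congr (\det _).
by apply/matrixP=> l j; rewrite !mxE -mu_polyE.
Qed.
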